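(* Let $r\ge 1$ and $n\ge 1$ be integers and let $p$ be a positive divisor of $r$ such that $\gcd(n,p,r/p)=1$. Then the complex reflection group $G(r,p,n)$ has a perfect Hilbertian basis.
   Context: Let $\mathbf Z_r=\mathbf Z/r\mathbf Z$. The wreath product $G(r,n)=\mathbf Z_r\wr S_n$ is the set of pairs $((c_1,\dots,c_n);\pi)$ with $c_i\in\mathbf Z_r$, $\pi\in S_n$, with multiplication $((c_1,\dots,c_n);\pi)\cdot((c'_1,\dots,c'_n);\pi')=((c_1+c'_{\pi^{-1}(1)},\dots,c_n+c'_{\pi^{-1}(n)});\pi\pi')$, where $(\pi\pi')(j)=\pi(\pi'(j))$. For $p\mid r$, $G(r,p,n)$ is the subgroup of those $((c_1,\dots,c_n);\pi)$ with $\sum_i c_i\equiv 0\pmod p$. With $\zeta=e^{2\pi i/r}$, $G(r,n)$ (hence $G(r,p,n)$) acts on $V=\mathbb C^n$ via $((c);\pi)\mapsto \mathrm{diag}(\zeta^{c_1},\dots,\zeta^{c_n})P_\pi$, where $P_\pi e_j=e_{\pi(j)}$; hence it acts on the polynomial ring $P_n=\mathbb C[x_1,\dots,x_n]$ (the symmetric algebra of $V^*$). For a finite group $G\subset GL(V)$, let $I^G$ be the ideal of $P_n$ generated by the $G$-invariant polynomials without constant term, $R^G=P_n/I^G=\bigoplus_k R^G_k$ the coinvariant algebra graded by degree, and $\mathrm{Hilb}_G(q)=\sum_k \dim R^G_k\, q^k$. A sequence $(a_1,\dots,a_m)$ of elements of a finite group $G$ is a basis if there are positive integers $m_1,\dots,m_m$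 such that every $g\in G$ has a unique presentation $g=a_1^{k_1}\cdots a_m^{k_m}$ with $0\le k_i<m_i$; it is a perfect basis if this holds with $m_i=o(a_i)$ (the order of $a_i$) for all $i$. For a basis $\mathbf a$, set $\mathrm{fmaj}_{(G,\mathbf a)}(g)=\sum_i k_i$ and $\mathrm{Fmaj}_{(G,\mathbf a)}(q)=\sum_{g\in G}q^{\mathrm{fmaj}_{(G,\mathbf a)}(g)}$. A (perfect) basis $\mathbf a$ of $G\subset GL(V)$ is a (perfect) Hilbertian basis if $\mathrm{Fmaj}_{(G,\mathbf a)}(q)=\mathrm{Hilb}_G(q)$. *)

(* Defs.v *)
From HB Require Import structures.
From mathcomp Require Import all_boot all_order all_algebra all_fingroup.
From mathcomp Require Import all_character.
From mathcomp Require Import generic_quotient ring_quotient.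
From mathcomp Require Import boolp reals trigo complex mpoly.

Set Implicit Arguments.
Unset Strict Implicit.
Unset Printing Implicit Defensive.

Import GRing.Theory Num.Theory.
Local Open Scope ring_scope.
Local Open Scope quotient_scope.

Section LinearAlgebra.
Variables (F : fieldType) (V : lmodType F).

Definition lincomb d (b : 'I_d -> V) (c : {ffun 'I_d -> F}) : V :=
  \sum_(i < d) c i *: b i.

(* W is a linear subspace of V of dimension d: it has a basis of d vectors. *)
Definition has_dim (W : V -> Prop) (d : nat) :=
  exists b : 'I_d -> V,
    injective (lincomb b) /\ (forall x, W x <-> exists c, x = lincomb b c).

End LinearAlgebra.

Section CoinvariantAlgebra.
Variables (F : fieldType) (gT : finGroupType) (G : {group gT}) (n : nat).
Variable rG : mx_representation F G n.
Implicit Types f : {mpoly F[n]}.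

(* G acts on V = F^n by column vectors, v |-> rG g *m v, and on Sym(V^* ) by
   (g . f)(v) = f(g^-1 v); thus g sends 'X_i to the i-th coordinate of
   rG g^-1 *m ('X_1, ..., 'X_n)^T. *)
Definition poly_act (g : gT) f : {mpoly F[n]} :=
  f \mPo [tuple \sum_(j < n) rG g^-1%g i j *: 'X_j | i < n].

Definition invariant_poly f := forall g, g \in G -> poly_act g f = f.

Definition coinv_ideal : {pred {mpoly F[n]}} := fun f =>
  `[< exists m (h u : 'I_m -> {mpoly F[n]}),
        (forall i, invariant_poly (u i) /\ (u i)@_0%MM = 0) /\
        f = \sum_(i < m) h i * u i >].

Lemma coinv_ideal_closed : idealr_closed coinv_ideal.
Proof.
split.
- apply/asboolP; exists 0%N, (fun=> 0), (fun=> 0).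
  by split; [case | rewrite big_ord0].
- apply/negP => /asboolP [m [h [u [uP]]]].
  move/(congr1 (mcoeff 0%MM)); rewrite mcoeff1 eqxx raddf_sum /=.
  rewrite big1 => [/eqP|i _]; first by rewrite oner_eq0.
  by rewrite rmorphM /= (uP i).2 mulr0.
- move=> a f g /asboolP [m [h [u [uP ->]]]] /asboolP [m' [h' [u' [uP' ->]]]].
  apply/asboolP; exists (m + m')%N.
  exists (fun i => match split i with inl j => a * h j | inr j => h' j end).
  exists (fun i => match split i with inl j => u j | inr j => u' j end).
  split; first by move=> i; case: (split i).
  rewrite big_split_ord /= mulr_sumr; congr (_ + _); apply: eq_bigr => i _.
    by rewrite (unsplitK (inl i)) mulrA.
  by rewrite (unsplitK (inr i)).
Qed.

HB.instance Definition _ :=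
  isIdealr.Build {mpoly F[n]} coinv_ideal coinv_ideal_closed.

Definition coinv := {ideal_quot coinv_ideal}.

HB.instance Definition _ := GRing.ComNzRing.on coinv.
HB.instance Definition _ := Quotient.on coinv.

Definition coinv_pi : {mpoly F[n]} -> coinv :=
  \pi_({ideal_quot coinv_ideal}).

Definition coinv_scale (c : F) (x : coinv) : coinv := coinv_pi c%:MP * x.

Fact coinv_scaleA a b x :
  coinv_scale a (coinv_scale b x) = coinv_scale (a * b) x.
Proof. by rewrite /coinv_scale /coinv_pi rmorphM /= rmorphM /= mulrA. Qed.

Fact coinv_scale1 : left_id 1 coinv_scale.
Proof. by move=> x; rewrite /coinv_scale /coinv_pi !rmorph1 mul1r. Qed.

Fact coinv_scaleDr : right_distributive coinv_scale +%R.
Proof. by move=> a x y; rewrite /coinv_scale mulrDr. Qed.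

Fact coinv_scaleDl x : {morph coinv_scale^~ x : a b / a + b}.
Proof. by move=> a b; rewrite /coinv_scale /coinv_pi !rmorphD mulrDl. Qed.

HB.instance Definition _ := GRing.Zmodule_isLmodule.Build F coinv
  coinv_scaleA coinv_scale1 coinv_scaleDr coinv_scaleDl.

Definition coinv_homog (k : nat) (x : coinv) : Prop :=
  exists2 f, f \is k.-homog & x = coinv_pi f.

(* Formal power series are given by their coefficient sequences. *)
Definition is_Hilb (h : nat -> nat) := forall k, has_dim (coinv_homog k) (h k).

End CoinvariantAlgebra.

Section Bases.
Variables (gT : finGroupType) (G : {group gT}) (s : nat).
Implicit Types (a : s.-tuple gT) (m : 'I_s -> nat).

Definition presentation a m (k : {dffun forall i : 'I_s, 'I_(m i)}) : gT :=
  (\prod_(i < s) tnth a i ^+ k i)%g.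

Definition basis_with a m :=
  [/\ forall i, tnth a i \in G,
      forall i, (0 < m i)%N
    & forall g, g \in G -> exists! k, g = @presentation a m k].

Definition orders a : 'I_s -> nat := fun i => #[tnth a i]%g.

Definition perfect_basis a := basis_with a (orders a).

(* Only meaningful under basis_with a m; the value 0 outside of the image of
   presentation is a dummy. *)
Definition fmaj a m (g : gT) : nat :=
  if [pick k | @presentation a m k == g] is Some k
  then (\sum_(i < s) k i)%N else 0%N.

Definition Fmaj a m : {poly nat} := \sum_(g in G) 'X^(fmaj a m g).

End Bases.

(* For a perfect basis the bounds in basis_with are necessarily the orders:
   each is at most the order by uniqueness, and their product is #|G|. *)
Definition perfect_hilbertian_basis (F : fieldType) (gT : finGroupType)
    (G : {group gT}) (n : nat) (rG : mx_representation F G n)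
    (s : nat) (a : s.-tuple gT) :=
  perfect_basis G a /\ is_Hilb rG (fun k => (Fmaj G a (orders a))`_k).

(* The wreath product of Z/r with S_n. For r > 0, Z/r is 'I_r.-1.+1 (and not
   'Z_r, which is Z/2 for r = 1). *)
Record wreath (r n : nat) := Wreath {
  wcol : {ffun 'I_n -> 'I_r.-1.+1};
  wperm : 'S_n }.

Section WreathGroup.
Variables r n : nat.
Implicit Types x y z : wreath r n.

Definition wreath_pair x := (wcol x, wperm x).
Definition pair_wreath (u : {ffun 'I_n -> 'I_r.-1.+1} * 'S_n) : wreath r n :=
  Wreath u.1 u.2.
Fact wreath_pairK : cancel wreath_pair pair_wreath.
Proof. by case. Qed.

HB.instance Definition _ := Countable.copy (wreath r n) (can_type wreath_pairK).
HB.instance Definition _ := Finite.copy (wreath r n) (can_type wreath_pairK).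

Lemma wreath_eq x y :
  wcol x =1 wcol y -> wperm x = wperm y -> x = y.
Proof. by case: x y => [c s] [d t] /= /ffunP -> ->. Qed.

(* In the library (s * t)%g j = t (s j), hence the reversed product. *)
Definition wreath_mul x y : wreath r n :=
  Wreath [ffun i => wcol x i + wcol y ((wperm x)^-1%g i)]
         (wperm y * wperm x)%g.

Definition wreath_one : wreath r n := Wreath [ffun=> 0] 1%g.

Definition wreath_inv x : wreath r n :=
  Wreath [ffun i => - wcol x (wperm x i)] (wperm x)^-1%g.

Fact wreath_mulA : associative wreath_mul.
Proof.
move=> x y z; apply: wreath_eq => [i|] /=; last by rewrite mulgA.
by rewrite !ffunE addrA invMg permM.
Qed.

Fact wreath_mul1 : left_id wreath_one wreath_mul.
Proof.
move=> x; apply: wreath_eq => [i|] /=; last by rewrite mulg1.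
by rewrite !ffunE add0r invg1 perm1.
Qed.

Fact wreath_mulV : left_inverse wreath_one wreath_inv wreath_mul.
Proof.
move=> x; apply: wreath_eq => [i|] /=; last by rewrite mulgV.
by rewrite !ffunE invgK addNr.
Qed.

HB.instance Definition _ := Finite_isGroup.Build (wreath r n)
  wreath_mulA wreath_mul1 wreath_mulV.

End WreathGroup.

Definition Grpn_set (r p n : nat) : {set wreath r n} :=
  [set x | p %| \sum_(i < n) (wcol x i : nat)]%N.

Lemma Grpn_group_set (r p n : nat) (dvd_pr : (p %| r)%N) :
  group_set (Grpn_set r p n).
Proof.
apply/group_setP; split=> [|x y]; rewrite !inE.
  by rewrite big1 // => i _; rewrite ffunE.
move=> px py; rewrite -(dvdn_addr _ px) in py.
case: r dvd_pr x y px py => [|r] dvd_pr x y px py.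
  by rewrite big1 // => i _; rewrite ord1.
rewrite /dvdn -modn_summ (eq_bigr (fun i =>
  (wcol x i + wcol y ((wperm x)^-1%g i)) %% p)%N).
  rewrite modn_summ big_split /=.
  have -> : (\sum_(i < n) wcol y ((wperm x)^-1%g i) = \sum_(i < n) wcol y i)%N.
    by rewrite (reindex_perm (wperm x)); apply: eq_bigr => i _; rewrite permK.
  exact: py.
by move=> i _; rewrite ffunE /= modn_dvdm.
Qed.

Definition Grpn (r p n : nat) (dvd_pr : (p %| r)%N) : {group wreath r n} :=
  Group (Grpn_group_set n dvd_pr).

Section ReflectionRepresentation.
Variables (R : realType) (r p n : nat).

(* exp(2 i pi / r) *)
Definition zeta : R[i] :=
  Complex (cos (2 * pi / r%:R)) (sin (2 * pi / r%:R)).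

Definition Grn_mx (x : wreath r n) : 'M[R[i]]_n :=
  diag_mx (\row_(i < n) zeta ^+ wcol x i) *m
  (\matrix_(i < n, j < n) (i == wperm x j)%:R).

Lemma Grn_mxE x i j :
  Grn_mx x i j = zeta ^+ wcol x i * (i == wperm x j)%:R.
Proof.
rewrite mxE (bigD1 i) //= !mxE eqxx mulr1n big1 ?addr0 // => k ki.
by rewrite !mxE eq_sym (negPf ki) mulr0n mul0r.
Qed.

Lemma zetaX k : zeta ^+ k = Complex (cos (2 * pi / r%:R * k%:R))
                                    (sin (2 * pi / r%:R * k%:R)).
Proof.
elim: k => [|k IHk]; first by rewrite expr0 mulr0 cos0 sin0.
rewrite exprSr IHk /zeta; set t := 2 * pi / _.
have -> : t * k.+1%:R = t * k%:R + t by rewrite -natr1 mulrDr mulr1.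
by rewrite cosD sinD; congr Complex; rewrite addrC.
Qed.

Lemma zeta_unity : (0 < r)%N -> zeta ^+ r = 1.
Proof.
move=> r_gt0; rewrite zetaX divfK ?pnatr_eq0 -?lt0n // mulr_natl.
by rewrite cos2pi mulr2n sinD sinpi mul0r mulr0 addr0.
Qed.

Lemma zetaD (a b : 'I_r.-1.+1) :
  zeta ^+ (a + b)%R = zeta ^+ a * zeta ^+ b.
Proof.
case: (posnP r) => [r0|r_gt0].
  have r1 (k : 'I_r.-1.+1) : k = 0%N :> nat.
    by case: k => k /=; rewrite r0 ltnS leqn0 => /eqP.
  by rewrite !r1 expr0 mulr1.
by rewrite -exprD expr_mod // prednK // zeta_unity.
Qed.

Lemma Grn_mx_repr (G : {set wreath r n}) : mx_repr G Grn_mx.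
Proof.
split=> [|x y _ _]; apply/matrixP => i j.
  by rewrite Grn_mxE ffunE perm1 expr0 mul1r mxE.
rewrite Grn_mxE [RHS]mxE (bigD1 ((wperm x)^-1%g i)) //= big1 => [|k ki].
  rewrite addr0 !Grn_mxE permKV eqxx mulr1 mulrA ffunE zetaD permM.
  by rewrite (canF_eq (permKV _)).
rewrite !Grn_mxE; case: eqP => [ik|]; last by rewrite mulr0 mul0r.
by rewrite ik permK eqxx in ki.
Qed.

Definition Grpn_repr (dvd_pr : (p %| r)%N) :
    mx_representation R[i] (Grpn n dvd_pr) n :=
  MxRepresentation (Grn_mx_repr (Grpn n dvd_pr)).

End ReflectionRepresentation.

(* Main.v *)
Require Import Defs.
From HB Require Import structures.
From mathcomp Require Import all_boot all_order all_algebra all_fingroup.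
From mathcomp Require Import all_solvable all_character.
From mathcomp Require Import ring_quotient boolp reals trigo complex mpoly.

(** Write y_i = X_i^r, d = r / p and g = (X_1 ... X_n)^d.

    The basis consists, for k < n, of a k-cycle on the first k coordinates with
    total colour 1 there and a correcting colour e on the last coordinate, and of
    an n-cycle with total colour p.  Their orders are r, 2r, ..., (n-1)r, nd, with
    product the order of the group.  The k-th element generates a cyclic group that
    meets trivially a subgroup containing the previous ones, so that the products
    a_1^k_1 ... a_n^k_n are pairwise distinct; for k = n this is where
    gcd(n, p, r/p) = 1 enters, through the choice of e.

    For the Hilbert series, let Z be the set of points whose coordinates have as
    r-th powers the n distinct n-th roots of unity.  The polynomials e_1(y), ...,
    e_(n-1)(y) vanish on the cone over Z.  Modulo them, the monomials with exponent
    less than ri in X_i (1 <= i < n) span, and a homogeneous combination of them that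
    vanishes on Z is zero.  An invariant takes on Z values that depend only on g,
    hence in each degree it is congruent to a multiple of a power of g on the cone:
    the coinvariant ideal consists of the polynomials congruent to a multiple of g
    there.  As g has no zero on Z, it is not a zero divisor modulo the ideal of the
    cone, and the Hilbert series is [r]_q [2r]_q ... [(n-1)r]_q [nd]_q. *)

Set Implicit Arguments.
Unset Strict Implicit.
Unset Printing Implicit Defensive.

From mathcomp Require Import ring lra.

Import Order.TTheory GRing.Theory Num.Theory.
Local Open Scope ring_scope.

(** * A perfect basis of G(r,p,n) *)

(** The last exponent is read off first: if u a_s^l = v a_s^l' with u and v in [H s], then a_s^(l' -
    l) lies in [H s], hence is 1. Cancelling the last factor leaves a shorter product. *)
Lemma prod_expg_inj (gT : finGroupType) (H : nat -> {group gT}) (a : nat -> gT)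
    (s : nat) (k k' : nat -> nat) :
    (forall i j, (j < i < s)%N -> a j \in H i) ->
    (forall i l, (i < s)%N -> (a i ^+ l)%g \in H i -> (a i ^+ l = 1)%g) ->
    (forall i, (i < s)%N -> (k i < #[a i]%g)%N) ->
    (forall i, (i < s)%N -> (k' i < #[a i]%g)%N) ->
    (\prod_(i < s) a i ^+ k i = \prod_(i < s) a i ^+ k' i)%g ->
  forall i, (i < s)%N -> k i = k' i.
Proof.
elim: s => // s IHs aH TI ltk ltk'.
rewrite !big_ord_recr /=; set x := (X in (X * _)%g = _).
set y := (X in _ = (X * _)%g) => eqxy.
have Hprod (l : nat -> nat) : (\prod_(i < s) a i ^+ l i)%g \in H s.
  by apply: group_prod => i _; apply: groupX; apply: aH; rewrite ltn_ord ltnSn.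
have aux (l l' : nat) (u v : gT) : u \in H s -> v \in H s ->
    (l <= l')%N -> (l' < #[a s]%g)%N -> (u * a s ^+ l = v * a s ^+ l')%g -> l = l'.
  move=> uH vH lel ltl /eqP.
  rewrite -(subnK lel) expgD mulgA => /eqP/mulIg def_u.
  have: (a s ^+ (l' - l))%g \in H s.
    by rewrite -(mulKg v (_ ^+ _)%g) -def_u groupM // groupV.
  move/TI => /(_ (ltnSn s))/eqP; rewrite -order_dvdn /dvdn modn_small; last first.
    by apply: leq_ltn_trans ltl; apply: leq_subr.
  by move/eqP=> ->.
have eqs : k s = k' s.
  case: (leqP (k s) (k' s)) => [le|/ltnW le].
    exact: (aux _ _ _ _ (Hprod k) (Hprod k') le (ltk' _ (ltnSn s)) eqxy).
  symmetry; apply: (aux _ _ _ _ (Hprod k') (Hprod k) le (ltk _ (ltnSn s))).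
  by rewrite eqxy.
move=> i; rewrite ltnS leq_eqVlt => /predU1P[-> //|lti].
apply: IHs lti => //.
- move=> i' j /andP[lt1 lt2]; apply: aH; rewrite lt1 /=; exact: ltnW.
- by move=> i' l lti'; apply: TI; apply: ltnW.
- by move=> i' lti'; apply: ltk; apply: ltnW.
- by move=> i' lti'; apply: ltk'; apply: ltnW.
- by move: eqxy; rewrite eqs => /mulIg.
Qed.

(** * Cycles with carry, and subgroups that avoid their powers *)

Section Odometer.
Variables r n' : nat.
Local Notation n := n'.+1.
Local Notation col := 'I_r.-1.+1.

Definition cyc_fun (k : nat) (j : 'I_n) : 'I_n :=
  if (j <= k)%N then inord (j.+1 %% k.+1) else j.

Lemma cyc_funE k j : (k < n)%N ->
  cyc_fun k j = (if j <= k then j.+1 %% k.+1 else j)%N :> nat.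
Proof.
move=> ltk; rewrite /cyc_fun; case: ifP => // _.
by rewrite inordK //; apply: leq_trans ltk; rewrite ltn_mod.
Qed.

Lemma cyc_fun_inj k : (k < n)%N -> injective (cyc_fun k).
Proof.
move=> ltk i j /(congr1 (@nat_of_ord _)); rewrite !cyc_funE // => eqij.
have lt_mod l : (l.+1 %% k.+1 <= k)%N by rewrite -ltnS ltn_mod.
apply: val_inj => /=; move: eqij; case: ifP => lei; case: ifP => lej //.
- move/eqP; rewrite -(addn1 i) -(addn1 j) eqn_modDr !modn_small ?ltnS //.
  by move/eqP.
- by move=> eqj; rewrite -eqj lt_mod in lej.
- by move=> eqi; rewrite eqi lt_mod in lei.
Qed.

(** The index is a natural number, as in [prod_expg_inj]; the value 1 for k >= n is a dummy. *)
Definition cyc k : 'S_n :=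
  if insub k is Some k' then perm (cyc_fun_inj (valP (k' : 'I_n))) else 1%g.

Lemma cycE k j : (k < n)%N ->
  cyc k j = (if j <= k then j.+1 %% k.+1 else j)%N :> nat.
Proof. by move=> ltk; rewrite /cyc insubT permE cyc_funE. Qed.

(* On pairs (position, colour), [odo k c d] adds 1 to the position modulo k + 1
   and carries into the colour; the last coordinate collects d if it is fixed. *)
Definition odo k (c d : col) : wreath r n :=
  Wreath [ffun i => if i == ord0 then c
                    else if (i == ord_max) && (k < n')%N then d else 0]
         (cyc k).

Lemma wmulP (x y : wreath r n) j : wperm (x * y)%g j = wperm x (wperm y j).
Proof. by rewrite [in LHS]/mulg /= permM. Qed.

Lemma wmulC (x y : wreath r n) j :
  wcol (x * y)%g (wperm x j) = wcol x (wperm x j) + wcol y j.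
Proof. by rewrite [in LHS]/mulg /= ffunE permK. Qed.

(** The power l adds l to the position j: the remainder modulo k + 1 is the new position, the
    quotient counts the carries. Colours are read at the image of j, where they add up ([wmulC]). *)
Lemma odoX k c d l j : (k < n)%N ->
  wperm (odo k c d ^+ l)%g j =
    (if j <= k then (j + l) %% k.+1 else j)%N :> nat /\
  wcol (odo k c d ^+ l)%g (wperm (odo k c d ^+ l)%g j) =
    if (j <= k)%N then c *+ ((j + l) %/ k.+1)
    else if j == ord_max then d *+ l else 0.
Proof.
move=> ltk; elim: l => [|l [IHp IHc]].
  rewrite expg0 /= perm1 addn0 ffunE; split.
    by case: ifP => // lej; rewrite modn_small.
  by case: ifP => [lej|_]; [rewrite divn_small|case: ifP].
rewrite expgS wmulP wmulC IHc; set j' := wperm _ j in IHp *.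
have cyc' := cycE j' ltk; rewrite -/j' in cyc'.
rewrite [wperm (odo _ _ _) _]/=.
move: IHp cyc'; case: (leqP j k) => [lej|ltj] IHp.
  rewrite IHp -ltnS ltn_mod /= -(addn1 (_ %% _)) modnDml addn1 addnS => cyc'.
  split=> //; rewrite ffunE -val_eqE /= cyc' divnS //.
  rewrite mulrnDr; congr (_ + _); rewrite -/(dvdn _ _).
  (* A carry occurs exactly when the new position is 0. Otherwise no colour is added: a position in
     the cycle is the last one only if k = n', and then d is absent. *)
  case: (boolP (k.+1 %| (j + l).+1)%N) => [|ndvd]; first by rewrite mulr1n.
  rewrite mulr0n; case: ifP => // /andP[/eqP/(congr1 val) /= eqc ltkn].
  have: (cyc k j' <= k)%N by rewrite cyc' -ltnS ltn_mod.
  by rewrite eqc leqNgt ltkn.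
have eqj : j' = j by apply: val_inj.
rewrite IHp leqNgt ltj /= => cyc'; split=> //.
have -> : cyc k j' = j by apply: val_inj; rewrite /= cyc'.
rewrite ffunE -val_eqE /= (gtn_eqF (leq_ltn_trans (leq0n _) ltj)).
case: eqP => [jmax|_] /=; last by rewrite addr0.
by rewrite -{1}[n']/(val (@ord_max n')) -jmax ltj mulrS.
Qed.

Lemma odoX_perm k c d l j : (k < n)%N ->
  wperm (odo k c d ^+ l)%g j =
    (if j <= k then (j + l) %% k.+1 else j)%N :> nat.
Proof. by move=> ltk; case: (odoX c d l j ltk). Qed.

Lemma odoX_col k c d l j : (k < n)%N ->
  wcol (odo k c d ^+ l)%g (wperm (odo k c d ^+ l)%g j) =
    if (j <= k)%N then c *+ ((j + l) %/ k.+1)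
    else if j == ord_max then d *+ l else 0.
Proof. by move=> ltk; case: (odoX c d l j ltk). Qed.

Lemma odoX1 k c d l : (k < n)%N -> c *+ l = 0 ->
    ((k < n')%N -> d *+ (k.+1 * l) = 0) ->
  (odo k c d ^+ (k.+1 * l) = 1)%g.
Proof.
move=> ltk cl0 dl0.
have fixp j : wperm (odo k c d ^+ (k.+1 * l))%g j = j.
  apply: val_inj => /=; rewrite odoX_perm //; case: ifP => // lej.
  by rewrite mulnC addnC modnMDl modn_small.
apply: wreath_eq => [j|]; last by apply/permP => j; rewrite fixp perm1.
rewrite -{1}(fixp j) odoX_col // ffunE; case: ifP => lej.
  by rewrite mulnC addnC divnMDl // divn_small // addn0.
rewrite dl0 ?if_same //; apply: (@leq_trans j); last by rewrite -ltnS.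
by rewrite ltnNge lej.
Qed.

(** Serves as [H] in [prod_expg_inj]: it contains the generators of smaller index, whose last colour
    is e times the colour of the others. *)
Definition flag_set (e k : nat) : {set wreath r n} :=
  [set x | [&& [forall j : 'I_n, (k <= j)%N ==> (wperm x j == j)],
               [forall j : 'I_n, (k <= j < n')%N ==> (wcol x j == 0)]
             & wcol x ord_max == (\sum_(j | j != ord_max) wcol x j) *+ e]].

Lemma flagP e k x : reflect
  [/\ forall j : 'I_n, (k <= j)%N -> wperm x j = j,
      forall j : 'I_n, (k <= j < n')%N -> wcol x j = 0
    & wcol x ord_max = (\sum_(j | j != ord_max) wcol x j) *+ e]
  (x \in flag_set e k).
Proof.
rewrite inE; apply: (iffP and3P) => [[/forallP h1 /forallP h2 /eqP h3]|[h1 h2 h3]].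
  by split=> // j lej; apply/eqP; [apply: (implyP (h1 j)) | apply: (implyP (h2 j))].
by split; [apply/forallP=> j; apply/implyP=> /h1 -> |
  apply/forallP=> j; apply/implyP=> /h2 -> | apply/eqP].
Qed.

(** Capping k at n' makes every element fix the last position, so that the last colour and the sum
    of the others are additive. *)
Lemma flag_group_set e k : group_set (flag_set e (minn k n')).
Proof.
have lek : (minn k n' <= n')%N by apply: geq_minr.
move: (minn k n') lek => {}k lek.
apply/group_setP; split.
  apply/flagP; split=> [j _|j _|]; rewrite ?perm1 ?ffunE //=.
  by rewrite big1 ?mul0rn // => i _; rewrite ffunE.
move=> x y /flagP[px cx sx] /flagP[py cy sy].
have fixV (j : 'I_n) : (k <= j)%N -> ((wperm x)^-1)%g j = j.
  by move=> lej; rewrite -{1}(px j lej) permK.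
apply/flagP; split=> [j lej|j lej|].
- by rewrite wmulP py // px.
- have lej' : (k <= j)%N by case/andP: lej.
  by rewrite /mulg /= ffunE fixV // cx // cy // addr0.
rewrite {1}/mulg /= ffunE fixV // sx sy -mulrnDl.
congr (_ *+ _).
rewrite [RHS](eq_bigr (fun j => wcol x j + wcol y ((wperm x)^-1%g j))).
  rewrite big_split /=; congr (_ + _).
  rewrite [RHS](reindex_perm (wperm x)); apply: eq_big => [j|j _].
    by rewrite -{2}(px ord_max) // (inj_eq perm_inj).
  by rewrite permK.
by move=> j _; rewrite /mulg /= ffunE.
Qed.

Definition flag e k : {group wreath r n} := Group (flag_group_set e k).

End Odometer.

(** * Perfect bases by counting, and the coefficients of [Fmaj] *)

Section FmajCount.
Variables (gT : finGroupType) (G : {group gT}) (s : nat) (a : s.-tuple gT).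

(** The image of [presentation] lies in G and has as many elements as the product of the orders,
    hence is G. *)
Lemma perfect_basis_of_inj :
    (forall i, tnth a i \in G) ->
    injective (@presentation _ _ a (orders a)) ->
    (#|G| <= \prod_i orders a i)%N ->
  perfect_basis G a.
Proof.
move=> aG inj leG; split=> // [i|g gG]; first exact: order_gt0.
pose im := [set presentation a k | k : {dffun forall i, 'I_(orders a i)}].
have imG : im \subset G.
  apply/subsetP => _ /imsetP[k _ ->]; apply: group_prod => i _.
  by rewrite groupX.
have card_im : #|im| = (\prod_i orders a i)%N.
  rewrite card_imset // card_dep_ffun foldrE big_map big_enum /=.
  by apply: eq_bigr => i _; rewrite card_ord.
have /eqP eqim : im == G :> {set gT} by rewrite eqEcard imG card_im.
rewrite -eqim in gG; case/imsetP: gG => k _ ->.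
by exists k; split=> // k' /inj.
Qed.

(** A perfect basis identifies G with the box of exponent vectors, on which [fmaj] is the sum of the
    entries. *)
Lemma coef_Fmaj d : perfect_basis G a ->
  (Fmaj G a (orders a))`_d =
  #|[set k : {dffun forall i, 'I_(orders a i)} | \sum_i k i == d]%N|.
Proof.
case=> aG _ ba.
have presG (k : {dffun forall i, 'I_(orders a i)}) : presentation a k \in G.
  by apply: group_prod => i _; rewrite groupX.
have inj : injective (@presentation _ _ a (orders a)).
  move=> k k' eqk; case: (ba _ (presG k)) => u [_ uP].
  by rewrite -(uP k) // -(uP k').
have defG : G = [set presentation a k | k : {dffun forall i, 'I_(orders a i)}] :> {set _}.
  apply/setP => g; apply/idP/imsetP => [/ba[k [-> _]]|[k _ ->]]; last exact: presG.
  by exists k.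
rewrite /Fmaj defG big_imset /=; last by move=> k k' _ _ /inj.
rewrite coef_sum -sum1_card big_mkcond [RHS]big_mkcond.
apply: eq_bigr => k _; rewrite !inE /= coefXn /fmaj.
case: pickP => [k' /eqP/inj ->|/(_ k)]; last by rewrite eqxx.
by rewrite eq_sym; case: eqP.
Qed.

End FmajCount.

(** * Multiples of 1 in Z/r *)

Section ColourArithmetic.
Variable r : nat.
Hypothesis r_gt0 : (0 < r)%N.

Lemma Zp1_mulrnE k : (Zp1 : 'I_r.-1.+1) *+ k = (k %% r)%N :> nat.
Proof. by rewrite Zp_mulrn /= !prednK // modnMml mul1n. Qed.

Lemma Zp1_mulrn_eq k l : (Zp1 : 'I_r.-1.+1) *+ k = Zp1 *+ l <-> k = l %[mod r].
Proof.
split=> [/(congr1 (@nat_of_ord _))|eqkl]; first by rewrite !Zp1_mulrnE.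
by apply: val_inj; rewrite /= !Zp1_mulrnE.
Qed.

Lemma Zp1_mulrn_eq0 k : ((Zp1 : 'I_r.-1.+1) *+ k == 0) = (r %| k)%N.
Proof. by rewrite -val_eqE /= Zp1_mulrnE. Qed.

End ColourArithmetic.

(** With e = p f - 1 the number is n' e - 1. Let a prime l divide it and m. If l divides n, it
    divides n' p f, but neither n' = n - 1, nor p by the gcd hypothesis, nor f, which is prime to n.
    Otherwise l divides f, the part of m prime to n, hence also n. *)
Lemma coprime_twist n' p m (f := (m`_(\pi(n'.+1)^'))%N) : (0 < m)%N ->
    gcdn n'.+1 (gcdn p m) = 1%N ->
  coprime m `|((n' * (p * f))%N%:Z - n'.+1%:Z)%R|%N.
Proof.
move=> m_gt0 gcd1; rewrite /coprime; apply/negPn/negP => ne1.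
set D := `|_|%N in ne1.
have [l prl /[!dvdn_gcd]/andP[ldm]] : exists2 l, prime l & (l %| gcdn m D)%N.
  have gt1 : (1 < gcdn m D)%N by rewrite ltn_neqAle eq_sym ne1 gcdn_gt0 m_gt0.
  by exists (pdiv (gcdn m D)); [apply: pdiv_prime | apply: pdiv_dvd].
rewrite /D => ldD; have {ldD} : (l%:Z %| (n' * (p * f))%N%:Z - n'.+1%:Z)%Z by rewrite dvdzE.
move=> ldD.
have [ldn|lndn] := boolP (l %| n'.+1)%N.
  have : (l%:Z %| (n' * (p * f))%N%:Z)%Z.
    by rewrite -(subrK n'.+1%:Z (n' * _)%N%:Z) rpredD // dvdzE.
  rewrite dvdzE /= !Euclid_dvdM // => /or3P[ldn'|ldp|ldf].
  - by move: (dvdn_sub ldn ldn'); rewrite subSnn dvdn1 => /eqP l1; rewrite l1 in prl.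
  - have: (l %| gcdn n'.+1 (gcdn p m))%N by rewrite !dvdn_gcd ldn ldp ldm.
    by rewrite gcd1 dvdn1 => /eqP l1; rewrite l1 in prl.
  - have /pnatP/(_ l prl ldf) : (\pi(n'.+1)^').-nat f := part_pnat _ _.
    by move/(_ (part_gt0 _ _)); rewrite !inE mem_primes prl ldn.
have ldf : (l %| f)%N.
  have: l \in \pi(f).
    by rewrite pi_of_part // !inE !mem_primes prl m_gt0 ldm (negPf lndn).
  by rewrite mem_primes => /and3P[].
case/negP: lndn; suff: (l%:Z %| n'.+1%:Z)%Z by rewrite dvdzE.
have -> : n'.+1%:Z = (n' * (p * f))%N%:Z - ((n' * (p * f))%N%:Z - n'.+1%:Z).
  by rewrite opprB addrC subrK.
by rewrite rpredB // dvdzE /= !dvdn_mull.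
Qed.

(** * The generators, their orders and their independence *)

Section GrpnBasis.
Variables r n' p : nat.
Local Notation n := n'.+1.
Hypotheses (r_gt0 : (0 < r)%N) (p_gt0 : (0 < p)%N).
Hypotheses (dvd_pr : (p %| r)%N) (gcd1 : gcdn n (gcdn p (r %/ p)) = 1%N).
Local Notation m := (r %/ p)%N.
Local Notation f := ((r %/ p)`_(\pi(n)^'))%N.
Local Notation e := ((p * f).-1)%N.

Let m_gt0 : (0 < m)%N. Proof. by rewrite divn_gt0 // dvdn_leq. Qed.
Let def_r : r = (p * m)%N. Proof. by rewrite mulnC divnK. Qed.
Let def_e : e.+1 = (p * f)%N. Proof. by rewrite prednK // muln_gt0 p_gt0 part_gt0. Qed.

(* e is chosen so that p | 1 + e, which puts the generators in G(r,p,n), and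
   e (n - 1) - 1 is invertible modulo r / p, which makes the basis perfect. *)
Definition Grpn_gen k : wreath r n :=
  odo n' k (if (k < n')%N then Zp1 else Zp1 *+ p) (Zp1 *+ e).

Definition Grpn_ord k := (if (k < n')%N then k.+1 * r else k.+1 * m)%N.

Lemma Grpn_gen_flag k j : (j < k)%N -> (k <= n')%N ->
  Grpn_gen j \in flag r n' e k.
Proof.
move=> ltjk lek; have ltj := leq_trans ltjk lek.
apply/flagP; rewrite (minn_idPl lek); split=> [i lei|i /andP[lei lti]|].
- apply: val_inj; rewrite /= cycE; last exact: ltnW.
  by rewrite leqNgt (leq_trans ltjk lei).
- have i_gt0 : (0 < i)%N := leq_ltn_trans (leq0n j) (leq_trans ltjk lei).
  by rewrite ffunE -!val_eqE /= (gtn_eqF i_gt0) (ltn_eqF lti).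
rewrite ffunE eqxx ltj /= -val_eqE /= (gtn_eqF (leq_ltn_trans (leq0n _) ltj)).
rewrite (bigD1 ord0) /=; last first.
  by rewrite -val_eqE /= (ltn_eqF (leq_ltn_trans (leq0n _) ltj)).
rewrite big1 => [|i /andP[i1 i2]]; last by rewrite ffunE (negPf i1) (negPf i2).
by rewrite addr0 ffunE eqxx ltj.
Qed.

(** Fixing position k forces l = (k + 1) q; the power is then a pure colouring, equal to c q on the
    positions up to k. For k < n' the colour of position k must vanish, so r divides q. *)
Lemma Grpn_gen_TI k l : (k <= n')%N ->
  (Grpn_gen k ^+ l)%g \in flag r n' e k -> (Grpn_ord k %| l)%N.
Proof.
rewrite /Grpn_gen /Grpn_ord => lek /flagP; rewrite (minn_idPl lek).
set c := (if _ then _ else _); set d := (_ *+ e); set x := (odo _ _ _ _ ^+ l)%g.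
case=> px cx sx.
have kn : (k < n)%N by [].
have dvdl : (k.+1 %| l)%N.
  have := congr1 (@nat_of_ord _) (px (Ordinal kn) (leqnn k)).
  rewrite odoX_perm //= leqnn => eqk.
  by rewrite -(dvdn_addr _ (dvdnn _)) addSnnS /dvdn addnS -addn1 -modnDml eqk
     addn1 modnn.
case/dvdnP: dvdl => q def_l; rewrite -(fun_if (muln k.+1)) def_l (mulnC q).
rewrite dvdn_pmul2l //.
have xfix j : wperm x j = j.
  apply: val_inj => /=; rewrite odoX_perm //; case: ifP => // lej.
  by rewrite def_l addnC modnMDl modn_small.
have xcol (j : 'I_n) : (j <= k)%N -> wcol x j = c *+ q.
  move=> lej; rewrite -{1}(xfix j) odoX_col // lej def_l addnC divnMDl //.
  by rewrite divn_small // addn0.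
move: lek; rewrite leq_eqVlt => /predU1P[eqk|ltk]; last first.
  have := cx (Ordinal kn); rewrite leqnn ltk => /(_ isT).
  by rewrite xcol //= /c ltk => /eqP; rewrite Zp1_mulrn_eq0.
move: sx; rewrite /c eqk ltnn in xcol *.
rewrite (eq_bigr (fun=> (Zp1 *+ p *+ q))) => [|j _]; last by rewrite xcol // -ltnS.
rewrite sumr_const xcol // -!mulrnA; have -> : #|[pred j : 'I_n | j != ord_max]| = n'.
  by have := cardC1 (@ord_max n'); rewrite card_ord.
move/(Zp1_mulrn_eq r_gt0)/eqP; rewrite -eqz_nat -!modz_nat eqz_mod_dvd => dvdr.
(* For k = n' the last colour is e times the sum of the n' equal others, so r divides p q (n' e -
   1). Cancelling p and the factor prime to r / p shows that r / p divides q. *)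
have: (r%:Z %| (p * q)%N%:Z * ((n' * (p * f))%N%:Z - n%:Z))%Z.
  suff -> : (p * q)%N%:Z * ((n' * (p * f))%N%:Z - n%:Z) =
      - ((p * q)%N%:Z - (p * q * n' * e)%N%:Z) by rewrite rpredN.
  by rewrite -def_e mulnS -[n]addn1 !PoszD !PoszM; ring.
rewrite (_ : r%:Z = p%:Z * m%:Z); last by rewrite -PoszM -def_r.
rewrite (PoszM p) -mulrA dvdz_mul2l; last by rewrite -lt0n.
rewrite Gauss_dvdzl; last first.
  by rewrite coprimezE; apply: coprime_twist.
by rewrite dvdzE.
Qed.

Lemma Grpn_gen_ord k : (k <= n')%N -> #[Grpn_gen k]%g = Grpn_ord k.
Proof.
move=> lek; apply/eqP; rewrite eqn_dvd; apply/andP; split; last first.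
  by apply: Grpn_gen_TI; rewrite // expg_order group1.
rewrite order_dvdn /Grpn_gen /Grpn_ord; apply/eqP.
case: ifP => ltk; apply: odoX1 => //.
- by apply/eqP; rewrite Zp1_mulrn_eq0.
- by move=> _; apply/eqP; rewrite -mulrnA Zp1_mulrn_eq0 // mulnA dvdn_mull.
- by apply/eqP; rewrite -mulrnA Zp1_mulrn_eq0 // -def_r.
- by rewrite ltk.
Qed.

Lemma wcol_sum_mul (x y : wreath r n) :
  (\sum_i wcol (x * y)%g i = \sum_i wcol x i + \sum_i wcol y i %[mod p])%N.
Proof.
rewrite -modn_summ (eq_bigr (fun i =>
  (wcol x i + wcol y ((wperm x)^-1%g i)) %% p)%N).
  rewrite modn_summ big_split /=; congr ((_ + _) %% _)%N.
  by rewrite (reindex_perm (wperm x)); apply: eq_bigr => i _; rewrite permK.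
by move=> i _; rewrite /mulg /= ffunE /= modn_dvdm // prednK.
Qed.

Lemma card_wreath : #|{: wreath r n}| = (r ^ n * n`!)%N.
Proof.
have /bij_eq_card -> : bijective (@wreath_pair r n).
  by exists (@pair_wreath r n); [apply: wreath_pairK | case].
by rewrite card_prod card_ffun !card_ord prednK // card_Sn.
Qed.

(** The p elements [t i], of colour sum i modulo p, lie in distinct cosets of G(r,p,n). *)
Lemma card_Grpn : (#|Grpn n dvd_pr| * p <= r ^ n * n`!)%N.
Proof.
pose t (i : 'I_p) : wreath r n :=
  Wreath [ffun j => if j == ord0 then Zp1 *+ i else 0] 1%g.
have sum_t i : (\sum_j wcol (t i) j = i %[mod p])%N.
  rewrite (bigD1 ord0) //= big1 => [|j /negPf j0]; rewrite ffunE ?j0 //=.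
  by rewrite Zp1_mulrnE // addn0 modn_dvdm.
rewrite -card_wreath; have -> : (#|Grpn n dvd_pr| * p)%N =
    #|setX (Grpn n dvd_pr) [set: 'I_p]| by rewrite cardsX cardsT card_ord.
have inj : {in setX (Grpn n dvd_pr) [set: 'I_p] &,
    injective (fun u => u.1 * t u.2)%g}.
  move=> [x i] [y j] /setXP[/= xG _] /setXP[/= yG _] eqxy.
  have eqij : i = j.
    apply: val_inj => /=; rewrite -(modn_small (ltn_ord i)) -(modn_small (ltn_ord j)).
    have h (z : wreath r n) k : z \in Grpn n dvd_pr ->
        (\sum_l wcol (z * t k)%g l = k %[mod p])%N.
      rewrite inE => /eqP zG.
      by rewrite wcol_sum_mul -modnDml zG add0n sum_t.
    by rewrite -(h x i xG) eqxy h.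
  by move: eqxy; rewrite eqij => /mulIg ->.
by rewrite -(card_in_imset inj) max_card.
Qed.

Lemma card_Grpn_prod : (#|Grpn n dvd_pr| <= \prod_(k < n) Grpn_ord k)%N.
Proof.
rewrite -(leq_pmul2r p_gt0); apply: leq_trans card_Grpn _.
rewrite big_ord_recr /= /Grpn_ord ltnn.
rewrite (eq_bigr (fun k : 'I_n' => (k.+1 * r)%N)) => [|k _]; last by rewrite ltn_ord.
rewrite big_split /= prod_nat_const card_ord expnS factS fact_prod big_add1 big_mkord.
rewrite -[X in (_ <= X)%N]mulnA -[(n * m * p)%N]mulnA [(m * p)%N]mulnC -def_r.
by rewrite mulnACA mulnC [(r ^ n' * _)%N]mulnC [(r * n)%N]mulnC.
Qed.

Lemma Grpn_gen_in k : (k <= n')%N -> Grpn_gen k \in Grpn n dvd_pr.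
Proof.
move=> lek; rewrite inE (bigD1 ord0) //= ffunE eqxx.
move: lek; rewrite leq_eqVlt => /predU1P[->|ltk].
  rewrite ltnn big1 => [|j /negPf j0]; last by rewrite ffunE j0 andbF.
  by rewrite addn0 Zp1_mulrnE // /dvdn modn_dvdm // modnn.
have max0 : (ord_max != ord0 :> 'I_n).
  by rewrite -val_eqE /= gtn_eqF // (leq_ltn_trans _ ltk).
rewrite ltk (bigD1 ord_max) //= big1 => [|j /andP[/negPf j0 /negPf j1]]; last first.
  by rewrite ffunE j0 j1.
rewrite ffunE (negPf max0) eqxx addn0 /= Zp1_mulrnE // prednK //.
rewrite /dvdn -modnDm !modn_dvdm // modnDm add1n def_e.
by rewrite modnMr.
Qed.

Definition Grpn_basis : n.-tuple (wreath r n) := [tuple Grpn_gen i | i < n].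

Lemma Grpn_basis_orders i : orders Grpn_basis i = Grpn_ord i.
Proof. by rewrite /orders tnth_mktuple Grpn_gen_ord // -ltnS. Qed.

Lemma Grpn_basis_inj : injective (@presentation _ _ Grpn_basis (orders Grpn_basis)).
Proof.
move=> k k'; rewrite /presentation => eqk.
(* Extends the exponents by 0 to all naturals, the form used in [prod_expg_inj]. *)
pose nk (k : {dffun forall i, 'I_(orders Grpn_basis i)}) (i : nat) : nat :=
  if insub i is Some i' then k i' : nat else 0%N.
have nkE (u : {dffun forall i, 'I_(orders Grpn_basis i)}) (i : 'I_n) : nk u i = u i.
  by rewrite /nk valK.
apply/ffunP => i; apply: val_inj => /=; rewrite -!nkE.
have lt_nk (u : {dffun forall i, 'I_(orders Grpn_basis i)}) j : (j < n)%N ->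
    (nk u j < #[Grpn_gen j]%g)%N.
  move=> ltj; rewrite -[j]/(val (Ordinal ltj)) nkE.
  by apply: leq_trans (ltn_ord _) _; rewrite /orders tnth_mktuple.
apply: (@prod_expg_inj _ (flag r n' e) Grpn_gen n) (ltn_ord i) => //.
- by move=> i' j /andP[ltj lti]; apply: Grpn_gen_flag.
- move=> j l ltj /Grpn_gen_TI dvdl; apply/eqP; rewrite -order_dvdn.
  by rewrite Grpn_gen_ord // dvdl.
- exact: lt_nk.
- exact: lt_nk.
have prodE (u : {dffun forall i, 'I_(orders Grpn_basis i)}) :
    (\prod_(i < n) Grpn_gen i ^+ nk u i = \prod_(i < n) tnth Grpn_basis i ^+ u i)%g.
  by apply: eq_bigr => j _; rewrite nkE tnth_mktuple.
by rewrite !prodE.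
Qed.

Lemma Grpn_perfect_basis : perfect_basis (Grpn n dvd_pr) Grpn_basis.
Proof.
apply: perfect_basis_of_inj.
- by move=> i; rewrite tnth_mktuple Grpn_gen_in // -ltnS.
- exact: Grpn_basis_inj.
- rewrite (eq_bigr (fun i : 'I_n => Grpn_ord i)) ?card_Grpn_prod // => i _.
  exact: Grpn_basis_orders.
Qed.

End GrpnBasis.

(** * Standard monomials *)

Section SupportedIn.
Variables (F : fieldType) (n : nat).
Implicit Types (f g : {mpoly F[n]}) (S : 'X_{1..n} -> Prop).

Definition supp_in S f := forall m, m \in msupp f -> S m.

Lemma supp_in0 S : supp_in S 0.
Proof. by move=> m; rewrite msupp0. Qed.

Lemma supp_inD S f g : supp_in S f -> supp_in S g -> supp_in S (f + g).
Proof.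
by move=> Sf Sg m /msuppD_le; rewrite mem_cat => /orP[/Sf|/Sg].
Qed.

Lemma supp_inN S f : supp_in S f -> supp_in S (- f).
Proof. by move=> Sf m; rewrite (perm_mem (msuppN f)) => /Sf. Qed.

Lemma supp_inZ S c f : supp_in S f -> supp_in S (c *: f).
Proof. by move=> Sf m /msuppZ_le /Sf. Qed.

Lemma supp_in_sum S (I : Type) (s : seq I) (P : pred I) (f : I -> {mpoly F[n]}) :
  (forall i, P i -> supp_in S (f i)) -> supp_in S (\sum_(i <- s | P i) f i).
Proof.
by move=> Sf; elim/big_ind: _ => //; [apply: supp_in0 | apply: supp_inD].
Qed.

Lemma supp_inM S1 S2 S f g :
    (forall m1 m2, S1 m1 -> S2 m2 -> S (m1 + m2)%MM) ->
  supp_in S1 f -> supp_in S2 g -> supp_in S (f * g).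
Proof.
move=> SM Sf Sg m /msuppM_le /allpairsP[[m1 m2] /= [/Sf S1m /Sg S2m ->]].
exact: SM.
Qed.

Lemma supp_inX S m : S m -> supp_in S 'X_[m].
Proof. by move=> Sm m' /mem_msuppXP <-. Qed.

Lemma supp_in1 S : S 0%MM -> supp_in S 1.
Proof. by move=> S0; rewrite -mpolyX0; apply: supp_inX. Qed.

Lemma supp_inW S1 S2 f : (forall m, S1 m -> S2 m) -> supp_in S1 f -> supp_in S2 f.
Proof. by move=> S12 S1f m /S1f /S12. Qed.

End SupportedIn.

(** * Products of linear polynomials and their reversal *)

Section RevProd.
Variable A : comNzRingType.

Lemma coef_1subcX (c : A) (P : {poly A}) a :
  ((1 - c *: 'X) * P)`_a = P`_a - (if a is b.+1 then c * P`_b else 0).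
Proof.
rewrite mulrBl mul1r coefB -scalerAl coefZ coefXM.
by case: a => //=; rewrite mulr0.
Qed.

Lemma size_prod_1subcX k (y : nat -> A) :
  (size (\prod_(l < k) (1 - y l *: 'X))%R <= k.+1)%N.
Proof.
elim: k => [|k IHk]; first by rewrite big_ord0 size_poly1.
rewrite big_ord_recr /= mulrC; apply/leq_sizeP => j ltj.
rewrite coef_1subcX; case: j ltj => // j ltj.
by rewrite !(leq_sizeP _ _ IHk) ?mulr0 ?subr0 // ltnW.
Qed.

(** The product of the 1 - y_l X is the reciprocal of that of the X - y_l, here evaluated at z. *)
Lemma rev_prod_1subcX k (y : nat -> A) z :
  \sum_(a < k.+1) (\prod_(l < k) (1 - y l *: 'X))`_a * z ^+ (k - a) =
  \prod_(l < k) (z - y l).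
Proof.
elim: k => [|k IHk]; first by rewrite big_ord1 !big_ord0 coef1 mulr1.
rewrite [RHS]big_ord_recr /= -IHk.
have -> : \prod_(l < k.+1) (1 - y l *: 'X) =
    (1 - y k *: 'X) * \prod_(l < k) (1 - y l *: 'X).
  by rewrite big_ord_recr mulrC.
set P := \prod_(l < k) _.
under eq_bigr do rewrite coef_1subcX mulrBl.
rewrite sumrB mulrBr; congr (_ - _).
  rewrite big_ord_recr /= (leq_sizeP _ _ (size_prod_1subcX k y)) // mul0r addr0.
  rewrite mulr_suml; apply: eq_bigr => a _.
  by rewrite -mulrA -exprSr subSn // -ltnS.
rewrite big_ord_recl /= mul0r add0r mulr_suml; apply: eq_bigr => a _.
by rewrite /= subSS -mulrA mulrC.
Qed.

Lemma coef0_prod_1subcX (I : Type) (s : seq I) (P : pred I) (y : I -> A) :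
  (\prod_(l <- s | P l) (1 - y l *: 'X))`_0 = 1.
Proof.
elim/big_rec: _ => [|l Q _ IH]; first by rewrite coef1.
by rewrite coef_1subcX IH subr0.
Qed.

End RevProd.

(** * Standard monomials span modulo the symmetric functions *)

Section Spanning.
Variables (F : fieldType) (r n' : nat).
Local Notation n := n'.+1.
Local Notation S := {mpoly F[n]}.
Hypothesis r_gt0 : (0 < r)%N.

(** The coefficient of index a is (-1)^a e_a(y). *)
Definition sym_gen : {poly S} := \prod_(l < n) (1 - ('X_l ^+ r : S) *: 'X).

(** An abstract ideal, later the intersection of the coinvariant ideal with the ideal of the
    cone. *)
Variable K : S -> Prop.
Hypotheses (K0 : K 0) (KD : forall f g, K f -> K g -> K (f + g)).
Hypothesis KM : forall f g, K g -> K (f * g).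
Hypothesis K_sym : forall a, (0 < a < n)%N -> K sym_gen`_a.

Let eqK (T : 'X_{1..n} -> Prop) f := exists2 h, K (f - h) & supp_in T h.

Lemma eqK0 T : eqK T 0.
Proof. by exists 0; [rewrite subr0 | apply: supp_in0]. Qed.

Lemma eqKD T f g : eqK T f -> eqK T g -> eqK T (f + g).
Proof.
move=> [f' Kf Tf] [g' Kg Tg]; exists (f' + g'); last exact: supp_inD.
by rewrite opprD addrACA; apply: KD.
Qed.

Lemma eqK_sum T (I : eqType) (s : seq I) (f : I -> S) :
  {in s, forall i, eqK T (f i)} -> eqK T (\sum_(i <- s) f i).
Proof.
move=> Tf; rewrite big_seq; elim/big_rec: _ => [|i g si]; first exact: eqK0.
by apply: eqKD; apply: Tf.
Qed.

Lemma eqKM T1 T2 T f g :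
    (forall m1 m2, T1 m1 -> T2 m2 -> T (m1 + m2)%MM) ->
  eqK T1 f -> supp_in T2 g -> eqK T (f * g).
Proof.
move=> TM [h Kh Th] Tg; exists (h * g); last exact: supp_inM Th Tg.
by rewrite -mulrBl mulrC; apply: KM.
Qed.

Lemma eqKN T f : eqK T f -> eqK T (- f).
Proof.
move=> [h Kh Th]; exists (- h); last exact: supp_inN.
by rewrite -opprD -mulN1r; apply: KM.
Qed.

Lemma eqK_subst T f g : K (f - g) -> eqK T g -> eqK T f.
Proof.
move=> Kfg [h Kh Th]; exists h => //.
by rewrite -(subrK g f) -addrA; apply: KD.
Qed.

Lemma eqK_supp T f : supp_in T f -> eqK T f.
Proof. by exists f => //; rewrite subrr. Qed.

Definition tail i d (m : 'X_{1..n}) :=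
  mdeg m = d /\ forall j : 'I_n, (j <= i)%N -> m j = 0%N.

Lemma tailM i d e m1 m2 : tail i d m1 -> tail i e m2 -> tail i (d + e) (m1 + m2)%MM.
Proof.
move=> [<- t1] [<- t2]; split=> [|j lej]; first by rewrite mdegD.
by rewrite mnmDE t1 ?t2.
Qed.

Lemma tail_coef i b :
  supp_in (tail i (r * b)) (\prod_(l < n | (i < l)%N) (1 - ('X_l ^+ r : S) *: 'X))`_b.
Proof.
elim/big_rec: _ b => [|l P ltl IHP] b.
  rewrite coef1; case: eqP => [->|_]; last exact: supp_in0.
  apply: supp_in1; split; first by rewrite mdeg0 muln0.
  by move=> j _; rewrite mnm0E.
rewrite coef_1subcX; apply: supp_inD; first exact: IHP.
apply: supp_inN; case: b => [|b]; first exact: supp_in0.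
rewrite mpolyXn mulnS; apply: supp_inM (IHP b); first exact: tailM.
apply: supp_inX; split; first by rewrite mdegMn mdeg1 mul1n.
move=> j lej; rewrite mulmnE mnm1E; case: eqP => // eqlj.
by rewrite eqlj ltnNge lej in ltl.
Qed.

(* Modulo K, the product of the polynomials over l <= i and l > i is 1 up to degree
   n - 1, so the elementary symmetric functions of the first y_l are, up to sign, the
   complete ones of the others. *)
Lemma head_coef i a : (i < n)%N -> (a < n)%N ->
  eqK (tail i (r * a)) (\prod_(l < n | (l <= i)%N) (1 - ('X_l ^+ r : S) *: 'X))`_a.
Proof.
move=> ltin; elim/ltn_ind: a => a IHa lta.
set PA := \prod_(l < n | _) _; set PB := \prod_(l < n | (i < l)%N) (1 - ('X_l ^+ r : S) *: 'X).
have defP : sym_gen = PA * PB.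
  rewrite /sym_gen (bigID (fun l : 'I_n => (l <= i)%N)) /=; congr (_ * _).
  by apply: eq_bigl => l; rewrite -ltnNge.
have PB0 : PB`_0 = 1 by apply: coef0_prod_1subcX.
have [->|a_gt0] := posnP a.
  rewrite coef0_prod_1subcX; apply: eqK_supp; apply: supp_in1.
  by split=> [|j _]; rewrite ?mdeg0 ?muln0 ?mnm0E.
have -> : PA`_a = sym_gen`_a - \sum_(j < a) PA`_j * PB`_(a - j).
  by rewrite defP coefM big_ord_recr /= subnn PB0 mulr1 [X in X - _]addrC addrK.
apply: eqKD.
  apply: (@eqK_subst _ _ 0); last exact: eqK0.
  by rewrite subr0; apply: K_sym; rewrite a_gt0.
apply: eqKN; apply: eqK_sum => j _.
apply: (@eqKM (tail i (r * j)) (tail i (r * (a - j)))).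
- move=> m1 m2 t1 t2; have := tailM t1 t2.
  by rewrite -mulnDr subnKC // ltnW.
- by apply: IHa => //; apply: ltn_trans lta.
- exact: tail_coef.
Qed.

(** y_i is a root of the product of the z - y_l for l <= i. Modulo [K] its non-leading coefficients
    involve later variables only, so the equation rewrites X_i^(r (i + 1)) with smaller
    monomials. *)
Lemma reduce_power i : (i < n')%N ->
  eqK (fun m => mdeg m = (r * i.+1)%N /\ (m < (U_(inord i) *+ (r * i.+1))%MM)%O)
    ('X_(inord i) ^+ (r * i.+1)).
Proof.
move=> lti; set I := inord i.
have valI : I = i :> nat by rewrite inordK // ltnW.
pose y l : S := 'X_(inord l) ^+ r.
have := rev_prod_1subcX i.+1 y (y i).
rewrite [RHS](bigD1 ord_max) //= subrr mul0r big_ord_recl /=.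
rewrite coef0_prod_1subcX mul1r subn0 /y -/I -exprM => /eqP.
rewrite addr_eq0 => /eqP ->; apply: eqKN; apply: eqK_sum => a _.
rewrite /bump /= add1n subSS.
have -> : \prod_(l < i.+1) (1 - ('X_(inord l) ^+ r : S) *: 'X) =
    \prod_(l < n | (l <= i)%N) (1 - ('X_l ^+ r : S) *: 'X).
  rewrite (big_ord_widen n (fun l => 1 - ('X_(inord l) ^+ r : S) *: 'X)) //; last exact: ltnW.
  by apply: eq_bigr => l _; rewrite inord_val.
rewrite -exprM mpolyXn.
apply: (@eqKM (tail i (r * a.+1)) (fun m => m = U_(I) *+ (r * (i - a)))%MM).
- move=> m1 _ [m1d m1i] ->; have lea : (a <= i)%N by rewrite -ltnS.
  have deg : mdeg (m1 + U_(I) *+ (r * (i - a)))%MM = (r * i.+1)%N.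
    by rewrite mdegD m1d mdegMn mdeg1 mul1n -mulnDr addSn subnKC.
  split=> //; apply/ltmcP; first by rewrite deg mdegMn mdeg1 mul1n.
  exists I => [j ltj|].
    rewrite mnmDE !mulmnE !mnm1E m1i; last by rewrite -valI ltnW.
    by rewrite -val_eqE (gtn_eqF ltj).
  rewrite mnmDE !mulmnE !mnm1E eqxx !mul1n m1i ?valI // add0n ltn_mul2l r_gt0 /=.
  by rewrite ltnS leq_subr.
- apply: head_coef => //; first exact: ltnW.
  by rewrite ltnS; apply: leq_ltn_trans lti; rewrite -ltnS.
- exact: supp_inX.
Qed.

(** The last exponent is unbounded: [K] is only assumed to contain e_1(y), ..., e_(n-1)(y). *)
Definition std_mnm (m : 'X_{1..n}) := [forall i : 'I_n, (i < n')%N ==> (m i < r * i.+1)%N].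

(** Induction on the monomial order: a factor X_i^(r (i + 1)) is replaced by [reduce_power], which
    keeps the degree. *)
Lemma std_span_mnm m : eqK (fun m' => std_mnm m' /\ mdeg m' = mdeg m) 'X_[m].
Proof.
elim/(ltmwf (n := n)): m => m IHm.
case: (pickP (fun i : 'I_n => (i < n') && (r * i.+1 <= m i))%N) => [i|nstd]; last first.
  apply: eqK_supp; apply: supp_inX; split=> //.
  apply/forallP => i; apply/implyP => lti.
  by have := nstd i; rewrite lti /= ltnNge => ->.
case/andP=> lti lem.
have [Q KQ TQ] := reduce_power lti; rewrite inord_val in KQ TQ.
set u := (U_(i) *+ (r * i.+1))%MM in TQ.
have lum : (u <= m)%MM.
  apply/mnm_lepP => j; rewrite mulmnE mnm1E; case: eqP => [<-|_].
    by rewrite mul1n.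
  by rewrite mul0n.
apply: (@eqK_subst _ _ ('X_[m - u] * Q)).
  rewrite -{1}(submK lum) addmC mpolyXD [_ * 'X_[m - u]]mulrC -mulrBr; apply: KM.
  by rewrite mpolyXn in KQ.
rewrite (mpolyE Q) mulr_sumr; apply: eqK_sum => m' Qm'.
rewrite -scalerAr -mpolyXD.
have [deg' lt'] := TQ _ Qm'.
have lt_m : ((m - u + m')%MM < m)%O by rewrite -{2}(submK lum) ltmc_add2r.
have deg_m : mdeg (m - u + m')%MM = mdeg m.
  by rewrite -{2}(submK lum) !mdegD deg' mdegMn mdeg1 mul1n.
have [h Kh Th] := IHm _ lt_m; rewrite deg_m in Th.
exists (Q@_m' *: h); last exact: supp_inZ.
by rewrite -scalerBr -mul_mpolyC; apply: KM.
Qed.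

Lemma std_span k f : f \is k.-homog ->
  exists2 h, K (f - h) & supp_in (fun m => std_mnm m /\ mdeg m = k) h.
Proof.
move/dhomogP => fk; rewrite [f]mpolyE; apply: eqK_sum => m fm.
have [h Kh Th] := std_span_mnm m; rewrite (fk _ fm) in Th.
exists (f@_m *: h); last exact: supp_inZ.
by rewrite -scalerBr -mul_mpolyC; apply: KM.
Qed.

End Spanning.

(** * Standard monomials are independent on Z *)

Section Points.
Variables (F : numFieldType) (r n' : nat) (xi : F).
Local Notation n := n'.+1.
Local Notation S := {mpoly F[n]}.
Hypothesis xiP : (r * n).-primitive_root xi.
Implicit Types (a : 'I_n -> nat) (f : S).

Definition pt a : 'I_n -> F := fun j => xi ^+ a j.

(* The r-th powers of the coordinates of [pt a] are then all n-th roots of 1. *)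
Definition valid a := injective (fun j => (a j %% n)%N).

(* Eliminates the variables one at a time: given the coordinates after i, there are
   r (i + 1) possible values for coordinate i, more than the degree in X_i. *)
Lemma std_vanish_partial k P :
    supp_in (fun m => std_mnm r m /\ mdeg m = k) P ->
    (forall a, valid a -> P.@[pt a] = 0) ->
  forall i, (i <= n')%N -> forall a (mo : 'X_{1..n}),
    {in [pred j : 'I_n | i <= j]%N &, injective (fun j => (a j %% n)%N)} ->
  \sum_(m <- msupp P | [forall j : 'I_n, (j < i)%N ==> (m j == mo j)])
    P@_m * \prod_(j < n | (i <= j)%N) pt a j ^+ m j = 0.
Proof.
move=> suppP P0; elim=> [|i IHi] lei a mo inj_a.
  rewrite -[RHS](P0 a) ?mevalE => [|j j']; last by apply: inj_a.
  apply: eq_big => // m; apply/forallP => j; exact/implyP.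
have lti : (i < n)%N by apply: ltnW.
pose I : 'I_n := Ordinal lti.
pose ag (m : 'X_{1..n}) := [forall j : 'I_n, (j < i)%N ==> (m j == mo j)].
(* The wanted sum is the coefficient of [q] at the exponent [mo I]; the values of [q] at admissible
   points are sums covered by the induction hypothesis. *)
pose q : {poly F} := \sum_(m <- msupp P | ag m)
  (P@_m * \prod_(j < n | (i < j)%N) pt a j ^+ m j) *: 'X^(m I).
suff q0 : q = 0.
  rewrite -[RHS](coef0 F (mo I)) -q0 /q coef_sum big_mkcond [RHS]big_mkcond; apply: eq_bigr => m _.
  rewrite coefZ coefXn; have -> : [forall j : 'I_n, (j < i.+1)%N ==> (m j == mo j)] =
      ag m && (mo I == m I).
    apply/forallP/andP => [agm|[/forallP agm /eqP eqI] j].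
      split; last by rewrite eq_sym; apply: (implyP (agm I)).
      by apply/forallP => j; apply/implyP => ltj; apply: (implyP (agm j)); apply: ltnW.
    apply/implyP; rewrite ltnS leq_eqVlt => /predU1P[eqj|ltj]; last exact: (implyP (agm j)).
    by have -> : j = I by [apply: val_inj]; rewrite eqI.
  by case: (ag m) => //=; case: eqP => _; rewrite ?mulr1 ?mulr0.
have size_q : (size q <= r * i.+1)%N.
  rewrite /q big_seq_cond; apply: (leq_trans (size_sum _ _ _)).
  apply/bigmax_leqP_seq => m _ /andP[/suppP[/forallP stdm _] _].
  apply: (leq_trans (size_scale_leq _ _)); rewrite size_polyXn.
  exact: (implyP (stdm I)).
have neqIE (j : 'I_n) : (i != j :> nat) = (j != I) by rewrite eq_sym -val_eqE.
(* The coordinates after i take at most n - i - 1 residues, so [rs] lists at least r (i + 1)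
   admissible values of coordinate i. *)
pose used := [set (inord (a j %% n)%N : 'I_n) | j in [pred j : 'I_n | (i < j)%N]].
pose rs := [seq xi ^+ (c + n * t)%N | c : 'I_n <- enum (~: used), t : nat <- iota 0 r].
apply/eqP; apply: contraTT isT => q_neq0.
have: (size rs < size q)%N.
  apply: max_poly_roots => //.
    apply/allP => _ /allpairsP[[c t] /= [cU _ ->]].
    rewrite mem_enum inE in cU; set b := (c + n * t)%N.
    pose a' j := if j == I then b else a j.
    have inj_a' : {in [pred j : 'I_n | i <= j]%N &, injective (fun j => (a' j %% n)%N)}.
      have fresh (j : 'I_n) : (i < j)%N -> (b %% n)%N != (a j %% n)%N.
        move=> ltj; apply: contra cU => /eqP eqb; apply/imsetP; exists j => //.
        by apply: val_inj; rewrite /= inordK ?ltn_mod // -eqb /b mulnC addnC modnMDl modn_small.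
      have neqI (j : 'I_n) : j \in [pred j : 'I_n | i <= j]%N -> j != I -> (i < j)%N.
        by rewrite inE => lej jI; rewrite ltn_neqAle lej andbT neqIE.
      move=> j j' ij ij' /=; rewrite /a'.
      case: (eqVneq j I) => [->|jI]; case: (eqVneq j' I) => [->|j'I] //.
      - by move/eqP; rewrite (negPf (fresh _ (neqI _ ij' j'I))).
      - by move/esym/eqP; rewrite (negPf (fresh _ (neqI _ ij jI))).
      - by apply: inj_a; apply: neqI.
    rewrite rootE /q horner_sum -[X in _ == X](IHi (ltnW lei) a' mo inj_a').
    apply/eqP; apply: eq_bigr => m _; rewrite hornerZ hornerXn -mulrA; congr (_ * _).
    rewrite [RHS](bigD1 I) //= mulrC /pt /a' eqxx; congr (_ * _).
    apply: eq_big => [j|j].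
      by rewrite ltn_neqAle andbC (neqIE j).
    move=> ltj; case: (eqVneq j I) => // jI.
    by rewrite jI ltnn in ltj.
  apply: allpairs_uniq; rewrite ?enum_uniq ?iota_uniq //.
  have lt_b (c : 'I_n) t : t \in iota 0 r -> (c + n * t < r * n)%N.
    rewrite mem_iota add0n /= => ltt; apply: (@leq_trans (n * t.+1)).
      by rewrite mulnS ltn_add2r.
    by rewrite mulnC leq_mul2r ltt orbT.
  move=> [c t] [c' t'] /allpairsP[[c1 t1] /= [_ tr [-> ->]]].
  move=> /allpairsP[[c2 t2] /= [_ tr' [-> ->]]] /= /eqP.
  rewrite (eq_prim_root_expr xiP) !modn_small ?lt_b // => /eqP eqb.
  have eqc : c1 = c2.
    apply: val_inj; have := congr1 (modn^~ n) eqb.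
    by rewrite /= ![(n * _)%N]mulnC ![(_ + _ * n)%N]addnC !modnMDl !modn_small.
  by move/eqP: eqb; rewrite eqc eqn_add2l eqn_pmul2l // => /eqP ->.
rewrite ltnNge (leq_trans size_q) // size_allpairs size_iota mulnC leq_mul2r -cardE.
apply/orP; right; rewrite -(leq_add2l #|used|) cardsC card_ord.
apply: (@leq_trans (n - i.+1 + i.+1)%N); last by rewrite subnK.
rewrite leq_add2r; apply: (leq_trans (leq_imset_card _ _)).
have -> : (n - i.+1)%N = #|~: [set widen_ord lti j | j : 'I_i.+1]|.
  rewrite cardsCs setCK card_ord card_imset ?card_ord //.
  by move=> u v /(congr1 val) /= /val_inj.
apply: subset_leq_card; apply/subsetP => j; rewrite !inE => ltj.
by apply/imsetP => -[u _ eqj]; rewrite eqj /= ltnNge -ltnS ltn_ord in ltj.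
Qed.

(** For i = n' and mo a monomial of P, the partial sum runs over the monomials that agree with mo
    before the last variable; by homogeneity only mo remains. *)
Lemma std_vanish k P :
    supp_in (fun m => std_mnm r m /\ mdeg m = k) P ->
    (forall a, valid a -> P.@[pt a] = 0) ->
  P = 0.
Proof.
move=> suppP P0; apply/eqP; rewrite -msupp_eq0; apply/eqP.
case def_s: (msupp P) => [//|mo s].
have moP : mo \in msupp P by rewrite def_s mem_head.
(* Exponents all 0 will do: injectivity is required on the last index only. *)
have inj0 : {in [pred j : 'I_n | n' <= j]%N &, injective (fun _ : 'I_n => (0 %% n)%N)}.
  move=> j j'; rewrite !inE => lej lej' _; apply: val_inj => /=.
  have := ltn_ord j; have := ltn_ord j'; rewrite !ltnS => lj lj'.
  by apply/eqP; rewrite eqn_leq (leq_trans lj' lej') (leq_trans lj lej).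
have := std_vanish_partial suppP P0 (leqnn n') mo inj0.
rewrite big_mkcond (bigD1_seq mo) ?msupp_uniq //= [X in _ + X]big1_seq ?addr0.
  have -> : [forall j : 'I_n, (j < n')%N ==> (mo j == mo j)].
    by apply/forallP => j; rewrite eqxx implybT.
  rewrite big1 => [|j _]; last by rewrite /pt expr0 expr1n.
  by rewrite mulr1 => mo0; move: moP; rewrite mcoeff_msupp mo0 eqxx.
move=> m /andP[neqm mP]; case: ifP => // /forallP ag; case/eqP: neqm.
have eq_lt (j : 'I_n) : (j < n')%N -> m j = mo j by move=> ltj; apply/eqP/(implyP (ag j)).
have [_ degm] := suppP _ mP; have [_ degmo] := suppP _ moP.
apply/mnmP => j; case: (ltnP j n') => [/eq_lt //|lej].
have -> : j = ord_max by apply: val_inj; apply/eqP; rewrite eqn_leq lej -ltnS ltn_ord.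
move: degm; rewrite -degmo !mdegE !big_ord_recr /=.
rewrite (eq_bigr (fun j : 'I_n' => mo (widen_ord (leqnSn n') j))) => [|u _].
  by move/eqP; rewrite eqn_add2l => /eqP.
by apply: eq_lt => /=.
Qed.

End Points.

(** * The cone over Z *)

(** The polynomial has the N roots 0, ..., N - 1, distinct in characteristic 0. *)
Lemma poly_fun_eq0 (F : numFieldType) N (c : nat -> F) :
  (forall t, \sum_(k < N) c k * t ^+ k = 0) -> forall k, (k < N)%N -> c k = 0.
Proof.
move=> c0 k ltk; pose q : {poly F} := \poly_(k < N) c k.
suff q0 : q = 0.
  by have := congr1 (fun u : {poly F} => u`_k) q0; rewrite coef_poly ltk coef0.
apply/eqP; apply: contraTT isT => q_neq0.
have: (size [seq i%:R : F | i <- iota 0 N] < size q)%N.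
  apply: max_poly_roots => //; last first.
    by rewrite map_inj_uniq ?iota_uniq // => i j /eqP; rewrite eqr_nat => /eqP.
  by apply/allP => _ /mapP[i _ ->]; rewrite rootE horner_poly c0.
by rewrite size_map size_iota ltnNge size_poly.
Qed.

(** * Homogeneous components and values along lines *)

Section Homogeneous.
Variables (F : numFieldType) (n : nat).
Implicit Types (f g : {mpoly F[n]}) (v : 'I_n -> F).

Lemma meval_homogZ k f t v : f \is k.-homog ->
  f.@[fun j => t * v j] = t ^+ k * f.@[v].
Proof.
move/dhomogP => fk; rewrite !mevalE mulr_sumr !big_seq; apply: eq_bigr => m fm.
rewrite mulrCA; congr (_ * _); have <- : mdeg m = k := fk _ fm.
rewrite mdegE.
under eq_bigr do rewrite exprMn.
by rewrite big_split /= -prodrXr.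
Qed.

Lemma pihomog_evalE f t v N : (msize f <= N)%N ->
  f.@[fun j => t * v j] = \sum_(k < N) (pihomog mdeg k f).@[v] * t ^+ k.
Proof.
move=> leN; rewrite {1}(pihomog_partitionE leN) raddf_sum /=.
by apply: eq_bigr => k _; rewrite (meval_homogZ _ _ (pihomogP _ _ _)) mulrC.
Qed.

(** Along the lines t v and t w, f and g are polynomials in t whose coefficients are the values of
    their components. *)
Lemma pihomog_eval_eq f g v w k :
    (forall t, f.@[fun j => t * v j] = g.@[fun j => t * w j]) ->
  (pihomog mdeg k f).@[v] = (pihomog mdeg k g).@[w].
Proof.
move=> eqfg; pose N := maxn k.+1 (maxn (msize f) (msize g)).
have lef : (msize f <= N)%N by rewrite !leq_max leqnn !orbT.
have leg : (msize g <= N)%N by rewrite !leq_max leqnn !orbT.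
apply/eqP; rewrite -subr_eq0; apply/eqP.
apply: (@poly_fun_eq0 _ N (fun k => (pihomog mdeg k f).@[v] - (pihomog mdeg k g).@[w])).
  move=> t; under eq_bigr do rewrite mulrBl.
  by rewrite sumrB -!pihomog_evalE // eqfg subrr.
by rewrite leq_max leqnn.
Qed.

Lemma pihomogM k d f g : g \is d.-homog ->
  pihomog mdeg k (g * f) = if (d <= k)%N then g * pihomog mdeg (k - d) f else 0.
Proof.
move=> gd; pose N := maxn (msize f) (k - d).+1.
have lef : (msize f <= N)%N by rewrite leq_max leqnn.
have gf_homog j : g * pihomog mdeg j f \is (d + j).-homog.
  by apply: dhomogM => //; apply: pihomogP.
rewrite {1}(pihomog_partitionE lef) mulr_sumr raddf_sum /=.
case: leqP => [led|ltd].
  have ltN : (k - d < N)%N by rewrite leq_max leqnn orbT.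
  rewrite (bigD1 (Ordinal ltN)) //= pihomog_dE; last first.
    by have := gf_homog (k - d)%N; rewrite subnKC.
  rewrite big1 ?addr0 // => j neqj; apply: (pihomog_ne0 _ (gf_homog j)).
  by apply: contra neqj => /eqP eqk; rewrite -val_eqE /= -eqk addKn.
rewrite big1 // => j _; apply: (pihomog_ne0 _ (gf_homog j)).
by rewrite gtn_eqF // (leq_trans ltd) // leq_addr.
Qed.

End Homogeneous.

(** * The ideal of the cone *)

Section Cone.
Variables (F : numFieldType) (r n' : nat) (xi : F).
Local Notation n := n'.+1.
Local Notation S := {mpoly F[n]}.
Hypothesis r_gt0 : (0 < r)%N.
Hypothesis xiP : (r * n).-primitive_root xi.
Implicit Types (a : 'I_n -> nat) (f g : S).

Let xi_neq0 : xi != 0.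
Proof. by rewrite (prim_root_eq0 xiP) muln_eq0 negb_or -!lt0n r_gt0. Qed.

(** The scalar t makes the zero set a cone, hence the ideal homogeneous ([vanish_pihomog]). *)
Definition vanish f :=
  forall t a, valid a -> f.@[fun j => t * pt xi a j] = 0.

Lemma vanish0 : vanish 0.
Proof. by move=> t a _; rewrite meval0. Qed.

Lemma vanishD f g : vanish f -> vanish g -> vanish (f + g).
Proof. by move=> f0 g0 t a va; rewrite mevalD f0 // g0 // addr0. Qed.

Lemma vanishM f g : vanish g -> vanish (f * g).
Proof. by move=> g0 t a va; rewrite mevalM g0 // mulr0. Qed.

Lemma vanish_homog k f : f \is k.-homog ->
  (forall a, valid a -> f.@[pt xi a] = 0) -> vanish f.
Proof. by move=> fk f0 t a va; rewrite (meval_homogZ _ _ fk) f0 // mulr0. Qed.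

Lemma vanish_pt f a : vanish f -> valid a -> f.@[pt xi a] = 0.
Proof.
by move=> f0 va; rewrite -(f0 1 a va); apply: meval_eq => j; rewrite mul1r.
Qed.

Lemma vanish_pihomog k f : vanish f -> vanish (pihomog mdeg k f).
Proof.
move=> f0; apply: (vanish_homog (pihomogP _ _ _)) => a va.
rewrite (@pihomog_eval_eq _ _ f 0 _ (pt xi a)) ?pihomog0 ?meval0 // => t.
by rewrite f0 // meval0.
Qed.

Lemma coef_prod_scale (I : Type) (s : seq I) (y : I -> F) c b :
  (\prod_(l <- s) (1 - (c * y l) *: 'X))`_b =
  c ^+ b * (\prod_(l <- s) (1 - y l *: 'X))`_b.
Proof.
elim: s b => [|l s IHs] b; first by rewrite !big_nil coef1; case: b => [|b];
  rewrite ?mulr1 ?mulr0.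
rewrite !big_cons !coef_1subcX !IHs mulrBr; congr (_ - _).
case: b => [|b]; first by rewrite mulr0.
by rewrite IHs exprS; ring.
Qed.

Lemma prod_valid a : valid a ->
  \prod_(l < n) (1 - xi ^+ (r * a l) *: 'X) =
  \prod_(l < n) (1 - xi ^+ (r * l) *: 'X) :> {poly F}.
Proof.
move=> va; pose h (l : 'I_n) : 'I_n := inord (a l %% n).
have hE l : h l = (a l %% n)%N :> nat by rewrite inordK // ltn_mod.
have /injF_bij h_bij : injective h.
  by move=> l l' /(congr1 (@nat_of_ord n)); rewrite !hE; apply: va.
rewrite [RHS](reindex h) /=; last exact: onW_bij.
have xirn : (xi ^+ r) ^+ n = 1 by rewrite -exprM (prim_expr_order xiP).
by apply: eq_bigr => l _; rewrite hE !exprM (expr_mod _ xirn).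
Qed.

(** Adding 1 to every exponent preserves the product but multiplies its coefficient b by xi^(r b),
    which is not 1. *)
Lemma coef_prod_valid a b : valid a -> (0 < b < n)%N ->
  (\prod_(l < n) (1 - xi ^+ (r * a l) *: 'X))`_b = 0.
Proof.
move=> va /andP[b_gt0 ltb].
have va1 : valid (fun j => (a j).+1).
  move=> j j' /= /eqP; rewrite -(addn1 (a j)) -(addn1 (a j')) eqn_modDr => /eqP.
  exact: va.
have: (\prod_(l < n) (1 - xi ^+ (r * (a l).+1) *: 'X))`_b =
      (\prod_(l < n) (1 - xi ^+ (r * a l) *: 'X))`_b.
  by rewrite (prod_valid va) (prod_valid va1).
under eq_bigr do rewrite mulnS exprD.
rewrite coef_prod_scale -[RHS]mul1r => /eqP; rewrite -subr_eq0 -mulrBl mulf_eq0.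
case/orP => [|/eqP //]; rewrite subr_eq0 -exprM -[1](expr0 xi).
rewrite (eq_prim_root_expr xiP) mod0n -/(dvdn _ _) dvdn_pmul2l //.
by rewrite gtnNdvd.
Qed.

Lemma vanish_sym_gen b : (0 < b < n)%N -> vanish (sym_gen F r n')`_b.
Proof.
move=> ltb t a va.
have -> : ((sym_gen F r n')`_b).@[fun j => t * pt xi a j] =
   (map_poly (meval (fun j => t * pt xi a j)) (sym_gen F r n'))`_b.
  by rewrite coef_map.
rewrite /sym_gen rmorph_prod /=.
rewrite (eq_bigr (fun l => 1 - (t ^+ r * xi ^+ (r * a l)) *: 'X)) => [|l _].
  by rewrite coef_prod_scale coef_prod_valid // mulr0.
rewrite rmorphB rmorph1 /= map_polyZ map_polyX rmorphXn /= mevalXU exprMn.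
by rewrite /pt -exprM mulnC.
Qed.

Definition gmon d : S := (\prod_(j < n) 'X_j) ^+ d.

Lemma gmon_homog d : gmon d \is (n * d).-homog.
Proof.
apply: dhomogMn.
suff h (s : seq 'I_n) : \prod_(j <- s) 'X_j \is [in F[n], (size s).-homog].
  by have := h (enum 'I_n); rewrite size_enum_ord big_enum.
elim: s => [|j s IHs]; first by rewrite big_nil dhomog1.
by rewrite big_cons; apply: (@dhomogM _ _ _ 1%N) => //; rewrite dhomogX /= mdeg1.
Qed.

Lemma meval_gmon d v : (gmon d).@[v] = (\prod_j v j) ^+ d.
Proof.
rewrite /gmon rmorphXn rmorph_prod /=; congr (_ ^+ _).
by apply: eq_bigr => j _; rewrite mevalXU.
Qed.

Lemma gmon_pt_neq0 d a : (gmon d).@[pt xi a] != 0.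
Proof.
rewrite meval_gmon expf_neq0 // prodf_seq_neq0; apply/allP => j _ /=.
by rewrite expf_neq0.
Qed.

End Cone.

(** * The Hilbert series *)

(** A basis of a complement of the kernel maps to a basis of the image. *)
Lemma has_dim_quotient (F : fieldType) (V : lmodType F) N M
    (phi : {linear 'rV[F]_N -> V}) (A : 'M[F]_(M, N)) :
    row_free A -> (forall u, phi u = 0 <-> (u <= A)%MS) ->
  has_dim (fun x => exists u, x = phi u) (N - M).
Proof.
move=> freeA kerA; have /eqP <- := freeA; rewrite -mxrank_compl.
pose B := row_base (A^C)%MS.
have lincombE c : lincomb (fun i => phi (row i B)) c = phi ((\row_i c i) *m B).
  rewrite mulmx_sum_row linear_sum; apply: eq_bigr => i _.
  by rewrite linearZ mxE.
exists (fun i => phi (row i B)); split=> [c c'|x].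
  rewrite !lincombE => /eqP; rewrite -subr_eq0 -linearB -mulmxBl => /eqP/kerA inA.
  have : ((\row_i c i - \row_i c' i) *m B <= A :&: A^C)%MS.
    by rewrite sub_capmx inA (submx_trans (submxMl _ _)) // eq_row_base.
  rewrite capmx_compl submx0 mulmx_free_eq0 ?row_base_free // subr_eq0 => /eqP eqc.
  by apply/ffunP => i; have /rowP/(_ i) := eqc; rewrite !mxE.
split=> [[u ->]|[c ->]]; last by exists ((\row_i c i) *m B).
have /sub_addsmxP[[u1 u2] /= def_u] : (u <= A + A^C)%MS.
  by rewrite submx_full // addsmx_compl_full.
have /submxP[w def_w] : (u2 *m A^C <= B)%MS by rewrite eq_row_base submxMl.
exists [ffun i => w 0 i]; rewrite lincombE def_u linearD def_w.
have /kerA -> : (u1 *m A <= A)%MS by apply: submxMl.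
rewrite add0r; congr (phi (_ *m _)).
by apply/rowP => i; rewrite mxE ffunE.
Qed.

(** * Coordinates on polynomials with finitely many allowed monomials *)

Section MonomialCoordinates.
Variables (F : fieldType) (n b : nat) (B : {set 'X_{1..n < b}}).
Implicit Types (P : {mpoly F[n]}) (u : 'rV[F]_#|B|).

Definition supp_set P := supp_in (fun m => exists2 m', m' \in B & m = bmnm m') P.

Definition of_coord u : {mpoly F[n]} := \sum_(i < #|B|) u 0 i *: 'X_[bmnm (enum_val i)].

Lemma of_coord_is_linear : linear of_coord.
Proof.
move=> c u v; rewrite /of_coord scaler_sumr -big_split; apply: eq_bigr => i _.
by rewrite !mxE scalerDl scalerA.
Qed.

HB.instance Definition _ :=
  GRing.isLinear.Build F 'rV[F]_#|B| {mpoly F[n]} _ of_coord of_coord_is_linear.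

Lemma of_coord_supp u : supp_set (of_coord u).
Proof.
apply: supp_in_sum => i _; apply: supp_inZ; apply: supp_inX.
by exists (enum_val i) => //; apply: enum_valP.
Qed.

Lemma of_coord_coef u (i : 'I_#|B|) : (of_coord u)@_(bmnm (enum_val i)) = u 0 i.
Proof.
rewrite /of_coord raddf_sum (bigD1 i) //= mcoeffZ mcoeffX eqxx mulr1.
rewrite big1 ?addr0 // => j neqj; rewrite mcoeffZ mcoeffX.
case: eqP => [/val_inj/enum_val_inj eqj|_]; last by rewrite mulr0.
by rewrite eqj eqxx in neqj.
Qed.

Lemma of_coord_inj : injective of_coord.
Proof. by move=> u v equv; apply/rowP => i; rewrite -!of_coord_coef equv. Qed.

Lemma of_coord_surj P : supp_set P -> exists u, P = of_coord u.
Proof.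
move=> PB; exists (\row_(i < #|B|) P@_(bmnm (enum_val i))); set u := \row_i _.
apply/mpolyP => m; case: (boolP [exists m' in B, bmnm m' == m]) => [|nB].
  case/exists_inP => m' m'B /eqP <-.
  by rewrite -[m'](enum_rankK_in m'B m'B) of_coord_coef mxE.
have coef0 Q : supp_set Q -> Q@_m = 0.
  move=> QB; apply/eqP; rewrite mcoeff_eq0; apply: contra nB => /QB[m' m'B ->].
  by apply/exists_inP; exists m'.
by rewrite !coef0 //; apply: of_coord_supp.
Qed.

End MonomialCoordinates.

(** * Dimensions of the graded pieces of the quotient *)

Section Dimension.
Variables (F : numFieldType) (r n' d : nat) (xi : F).
Local Notation n := n'.+1.
Local Notation S := {mpoly F[n]}.
Hypotheses (r_gt0 : (0 < r)%N) (xiP : (r * n).-primitive_root xi).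
Variable I : S -> Prop.
Hypotheses (I0 : I 0) (ID : forall f g, I f -> I g -> I (f + g)).
Hypothesis IM : forall f g, I g -> I (f * g).
Hypothesis I_sym : forall a, (0 < a < n)%N -> I (sym_gen F r n')`_a.
Hypothesis I_gmon : I (gmon F n' d).
Hypothesis I_dec : forall f, I f -> exists h, vanish xi (f - gmon F n' d * h).
Local Notation van := (@vanish F n' xi).
Local Notation g := (gmon F n' d).

(** [std_span] is applied to the intersection of [I] with the ideal of the cone, so that one
    remainder serves both. *)
Lemma std_normal_form k f : f \is k.-homog ->
  exists P, [/\ I (f - P), van (f - P)
              & supp_in (fun m => std_mnm r m /\ mdeg m = k) P].
Proof.
move=> fk; have [||||P [IP vP] sP] := @std_span F r n' r_gt0 (fun f => I f /\ van f) _ _ _ _ _ _ fk.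
- by split=> //; apply: vanish0.
- by move=> u v [Iu vu] [Iv vv]; split; [apply: ID | apply: vanishD].
- by move=> u v [Iv vv]; split; [apply: IM | apply: vanishM].
- by move=> a lta; split; [apply: I_sym | apply: (vanish_sym_gen r_gt0 xiP)].
by exists P.
Qed.

Lemma std_vanish0 k P :
  supp_in (fun m => std_mnm r m /\ mdeg m = k) P -> van P -> P = 0.
Proof.
move=> sP vP; apply: (std_vanish xiP sP) => a va; exact: vanish_pt.
Qed.

(** The standard remainder vanishes on the cone too, hence is zero. *)
Lemma vanish_homog_I k f : f \is k.-homog -> van f -> I f.
Proof.
move=> fk vf; have [P [IP vP sP]] := std_normal_form fk.
suff P0 : P = 0 by rewrite P0 subr0 in IP.
apply: (std_vanish0 sP); rewrite -(subKr f P); apply: vanishD => //.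
by rewrite -mulN1r; apply: vanishM.
Qed.

(** Taking components of degree k in [I_dec] makes the cofactor of g homogeneous; it is then
    replaced by its standard form. *)
Lemma std_in_I k P : supp_in (fun m => std_mnm r m /\ mdeg m = k) P -> I P ->
  exists2 h, supp_in (fun m => std_mnm r m /\ (mdeg m + n * d = k)%N) h
           & van (P - g * h).
Proof.
move=> sP /I_dec[h0 vh0].
have Pk : P \is k.-homog by apply/dhomogP => m /sP[].
have := vanish_pihomog k vh0; rewrite raddfB /= (pihomog_dE Pk).
rewrite (pihomogM _ _ (gmon_homog F n' d)); case: leqP => [led|_] vP; last first.
  by exists 0; [apply: supp_in0 | rewrite mulr0].
have [h [_ vh sh]] := std_normal_form (pihomogP mdeg (k - n * d) h0).
exists h; first by apply: supp_inW sh => m [stdm ->]; rewrite subnK.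
rewrite -(subrK (g * pihomog mdeg (k - n * d) h0) P) -addrA -mulrBr.
by apply: vanishD => //; apply: vanishM.
Qed.

Definition std_deg k : {set 'X_{1..n < k.+1}} :=
  [set m : 'X_{1..n < k.+1} | std_mnm r m & mdeg m == k].
(** The degree condition is an addition, so that the set is empty for k < n d, where a subtraction
    would truncate. *)
Definition std_deg_shift k : {set 'X_{1..n < k.+1}} :=
  [set m : 'X_{1..n < k.+1} | std_mnm r m & (mdeg m + n * d == k)%N].

Lemma std_degP k (P : S) : supp_in (fun m => std_mnm r m /\ mdeg m = k) P <->
  supp_set (std_deg k) P.
Proof.
split=> sP m /sP => [[stdm degm]|[m']].
  have ltm : (mdeg m < k.+1)%N by rewrite degm.
  by exists (BMultinom ltm) => //; rewrite inE /= stdm degm eqxx.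
by rewrite inE => /andP[stdm /eqP degm] ->.
Qed.

Lemma std_deg_shiftP k (P : S) :
  supp_in (fun m => std_mnm r m /\ (mdeg m + n * d = k)%N) P <->
  supp_set (std_deg_shift k) P.
Proof.
split=> sP m /sP => [[stdm degm]|[m']].
  have ltm : (mdeg m < k.+1)%N by rewrite ltnS -degm leq_addr.
  by exists (BMultinom ltm) => //; rewrite inE /= stdm degm eqxx.
by rewrite inE => /andP[stdm /eqP degm] ->.
Qed.

(** Multiplication by g followed by reduction sends standard polynomials of degree k - n d to those
    of degree k. It is injective, as g has no zero on Z, and its image is the kernel of [ph] on the
    latter. *)
Lemma coinv_dim (V : lmodType F) (ph : {linear S -> V}) k :
    (forall f, ph f = 0 <-> I f) ->
  has_dim (fun x => exists2 f, f \is k.-homog & x = ph f)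
    (#|std_deg k| - #|std_deg_shift k|).
Proof.
move=> kerph.
pose mk := @of_coord F n k.+1 (std_deg k).
pose mk' := @of_coord F n k.+1 (std_deg_shift k).
have mk_std u : supp_in (fun m => std_mnm r m /\ mdeg m = k) (mk u).
  exact/std_degP/of_coord_supp.
have mk'_std u : supp_in (fun m => std_mnm r m /\ (mdeg m + n * d = k)%N) (mk' u).
  exact/std_deg_shiftP/of_coord_supp.
have mk_homog u : mk u \is k.-homog by apply/dhomogP => m /mk_std[].
have gmk'_homog u : g * mk' u \is k.-homog.
  have [->|mk'_neq0] := eqVneq (mk' u) 0; first by rewrite mulr0 dhomog0.
  have h : mk' u \is (k - n * d).-homog.
    by apply/dhomogP => m /mk'_std[_ <-] /=; rewrite addnK.
  have led : (n * d <= k)%N.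
    by have [_ <-] := mk'_std _ _ (mlead_supp mk'_neq0); rewrite leq_addl.
  by rewrite -(subnKC led); apply: dhomogM h; apply: gmon_homog.
(* The rows of the matrix of this map: the standard form of g times each monomial. *)
have /fin_all_exists[A0 A0P] : forall i : 'I_#|std_deg_shift k|,
    exists u : 'rV[F]_#|std_deg k|, van (g * mk' (delta_mx 0 i) - mk u).
  move=> i.
  have [P [_ vP /std_degP/of_coord_surj[u def_u]]] :=
    std_normal_form (gmk'_homog (delta_mx 0 i)).
  by exists u; rewrite -[mk u]def_u.
pose A := \matrix_i A0 i.
have AP c : van (g * mk' c - mk (c *m A)).
  have -> : mk' c = \sum_i c 0 i *: mk' (delta_mx 0 i).
    rewrite {1}(row_sum_delta c) [LHS]linear_sum.
    by apply: eq_bigr => i _; rewrite [LHS]linearZ.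
  have -> : mk (c *m A) = \sum_i c 0 i *: mk (A0 i).
    rewrite mulmx_sum_row [LHS]linear_sum.
    by apply: eq_bigr => i _; rewrite [LHS]linearZ rowK.
  rewrite mulr_sumr -sumrB.
  elim/big_ind: _ => [|u v|i _]; [exact: vanish0 | exact: vanishD |].
  by rewrite -scalerAr -scalerBr -mul_mpolyC; apply: vanishM.
have freeA : row_free A.
  apply: inj_row_free => c cA0; have := AP c; rewrite cA0 [mk 0]linear0 subr0 => vgc.
  apply: (@of_coord_inj F n k.+1 (std_deg_shift k)).
  rewrite [RHS]linear0; have [//|mk'_neq0] := eqVneq (of_coord c) 0.
  have h : supp_in (fun m => std_mnm r m /\ mdeg m = (k - n * d)%N) (mk' c).
    by apply: supp_inW (mk'_std c) => m [stdm <-]; rewrite addnK.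
  apply: (std_vanish xiP h) => a va; apply/eqP.
  have /eqP := vanish_pt vgc va; rewrite mevalM mulf_eq0.
  by rewrite (negPf (gmon_pt_neq0 r_gt0 xiP d a)).
have kerA u : ph (mk u) = 0 <-> (u <= A)%MS.
  rewrite kerph; split=> [Iu|/submxP[c ->]].
    have [h /std_deg_shiftP/of_coord_surj[c def_c] vh] := std_in_I (mk_std u) Iu.
    apply/submxP; exists c; apply: (@of_coord_inj F n k.+1 (std_deg k)).
    apply/eqP; rewrite -subr_eq0 -linearB; apply/eqP.
    apply: (std_vanish0 (mk_std (u - c *m A))).
    rewrite [mk _]linearB -[X in X - _](subrK (g * h)) -addrA.
    by apply: vanishD => //; rewrite def_c; apply: AP.
  (* Conversely, it differs from a multiple of g by a homogeneous polynomial vanishing on the cone;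
     both lie in [I]. *)
  rewrite -(subKr (g * mk' c) (mk _)); apply: ID; first by rewrite mulrC; apply: IM.
  rewrite -mulN1r; apply: IM; apply: (@vanish_homog_I k); last exact: AP.
  by apply: rpredB; [apply: gmk'_homog | apply: mk_homog].
have := @has_dim_quotient F V _ _ (ph \o mk) A freeA kerA.
case=> b [binj bspan]; exists b; split=> // x; rewrite -bspan; split=> [[f fk ->]|[u ->]].
  have [P [IP _ /std_degP/of_coord_surj[u def_u]]] := std_normal_form fk.
  exists u; rewrite [RHS]/= -def_u; apply/eqP; rewrite -subr_eq0 -linearB.
  by apply/eqP/kerph.
by exists (mk u).
Qed.

End Dimension.

(** * Standard monomials and exponent vectors *)

Section CountStandard.
Variables (r n' d k : nat).
Local Notation n := n'.+1.
Local Notation u := (U_(@ord_max n') *+ (n * d))%MM.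
Local Notation B := (@std_deg r n' k).

Lemma std_mnmP (m : 'X_{1..n}) :
  reflect (forall i : 'I_n, (i < n')%N -> (m i < r * i.+1)%N) (std_mnm r m).
Proof.
by apply: (iffP forallP) => h i; [move=> lti; apply: (implyP (h i)) | apply/implyP/h].
Qed.

Definition std_deg_low := [set m in B | (m ord_max < n * d)%N].

Lemma top_mnmE (i : 'I_n) : u i = if (i < n')%N then 0%N else (n * d)%N.
Proof.
rewrite mulmnE mnm1E; case: eqP => [<-|/eqP neqi] /=; first by rewrite ltnn mul1n.
by rewrite ltn_neqAle eq_sym neqi -ltnS ltn_ord.
Qed.

(** Division by the power n d of the last variable is a bijection. *)
Lemma card_std_deg_high : #|B :\: std_deg_low| = #|std_deg_shift r n' d k|.
Proof.
pose f (m : 'X_{1..n < k.+1}) := BMultinom (leq_ltn_trans (mdegB m u) (bmdeg m)).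
have lum (m : 'X_{1..n < k.+1}) : m \in B :\: std_deg_low -> (u <= m)%MM.
  rewrite !inE => /andP[h Bm]; rewrite Bm -leqNgt /= in h.
  apply/mnm_lepP => i; rewrite top_mnmE; case: ltnP => // lei.
  by have -> : i = ord_max by apply: val_inj; apply/eqP; rewrite eqn_leq -ltnS ltn_ord.
rewrite -(@card_in_imset _ _ f); last first.
  move=> m1 m2 /lum lm1 /lum lm2 /(congr1 (@bmnm _ _)) /= eqm.
  by apply: val_inj; rewrite /= -(submK lm1) eqm submK.
apply: eq_card => m'; apply/imsetP/idP => [[m Em ->]|].
  have lm := lum _ Em; move: Em; rewrite !inE => /andP[_ /andP[/std_mnmP stdm /eqP degm]].
  apply/andP; split.
    by apply/std_mnmP => i lti /=; rewrite mnmBE (leq_ltn_trans (leq_subr _ _)) ?stdm.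
  by apply/eqP; rewrite -[RHS]degm -[in RHS](submK lm) mdegD mdegMn mdeg1 mul1n.
rewrite inE => /andP[/std_mnmP stdm /eqP degm].
have deg : mdeg (m' + u)%MM = k by rewrite mdegD mdegMn mdeg1 mul1n.
have ltk : (mdeg (m' + u)%MM < k.+1)%N by rewrite deg.
exists (BMultinom ltk); last by apply: val_inj; rewrite /= addmK.
rewrite !inE /= deg eqxx andbT mnmDE top_mnmE /= ltnn ltnNge leq_addl andbF /=.
by apply/std_mnmP => i lti; rewrite mnmDE top_mnmE lti addn0 stdm.
Qed.

Lemma card_std_deg_low (o : 'I_n -> nat) :
    (forall i : 'I_n, o i = if (i < n')%N then (r * i.+1)%N else (n * d)%N) ->
  #|std_deg_low| = #|[set x : {dffun forall i, 'I_(o i)} | \sum_i x i == k]%N|.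
Proof.
move=> oE; set D := [set x : {dffun _} | _].
pose h (x : {dffun forall i, 'I_(o i)}) : 'X_{1..n < k.+1} :=
  (* The default [bm0] is not reached on [D], where the degree is k. *)
  insubd bm0 [multinom (x i : nat) | i < n].
have hE x : x \in D -> bmnm (h x) = [multinom (x i : nat) | i < n].
  rewrite inE => /eqP sumx; rewrite /h /insubd insubT //.
  rewrite mdegE ltnS; under eq_bigr do rewrite mnmE.
  by rewrite sumx.
rewrite -[RHS](@card_in_imset _ _ h); last first.
  move=> x y Dx Dy /(congr1 (@bmnm _ _)); rewrite !hE // => eqxy.
  apply/ffunP => i; apply: val_inj => /=.
  by have := congr1 (fun m : 'X_{1..n} => m i) eqxy; rewrite !mnmE.
apply: eq_card => m; apply/idP/imsetP => [|[x Dx ->]].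
  rewrite !inE => /andP[/andP[/std_mnmP stdm /eqP degm] lt_max].
  have ltm i : (m i < o i)%N.
    rewrite oE; case: (ltnP i n') => [/stdm //|lei].
    by have -> : i = ord_max by apply: val_inj; apply/eqP; rewrite eqn_leq -ltnS ltn_ord.
  pose x : {dffun forall i, 'I_(o i)} := finfun (fun i => Ordinal (ltm i)).
  have Dx : x \in D.
    by rewrite inE; apply/eqP; rewrite -[RHS]degm mdegE; apply: eq_bigr => i _; rewrite ffunE.
  exists x => //; apply: val_inj; rewrite /= hE //.
  by apply/mnmP => i; rewrite mnmE ffunE.
have := Dx; rewrite !inE hE // => /eqP sumx.
have ltx (i : 'I_n) : (x i < if i < n' then r * i.+1 else n * d)%N.
  by rewrite -oE ltn_ord.
rewrite mnmE; have := ltx ord_max; rewrite /= ltnn => ->; rewrite andbT.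
apply/andP; split.
  by apply/std_mnmP => i lti; rewrite mnmE; have := ltx i; rewrite lti.
by rewrite mdegE; apply/eqP; rewrite -[RHS]sumx; apply: eq_bigr => i _; rewrite mnmE.
Qed.

Lemma card_std_diff (o : 'I_n -> nat) :
    (forall i : 'I_n, o i = if (i < n')%N then (r * i.+1)%N else (n * d)%N) ->
  (#|B| - #|std_deg_shift r n' d k|)%N =
  #|[set x : {dffun forall i, 'I_(o i)} | \sum_i x i == k]%N|.
Proof.
move=> oE; rewrite -(card_std_deg_low oE) -(cardsID std_deg_low B).
rewrite card_std_deg_high addnK; apply: eq_card => m; rewrite !inE.
by case: (std_mnm r m && _).
Qed.

End CountStandard.

(** * Values of the invariants on the cone *)

Section InvariantsOnCone.
Variables (F : numFieldType) (r n' p d : nat) (zeta xi : F).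
Local Notation n := n'.+1.
Local Notation S := {mpoly F[n]}.
Hypotheses (r_gt0 : (0 < r)%N) (def_r : r = (p * d)%N).
Hypotheses (zetaP : r.-primitive_root zeta) (xiP : (r * n).-primitive_root xi).
Local Notation g := (gmon F n' d).
Implicit Types (a b : 'I_n -> nat) (u : S).

Let p_gt0 : (0 < p)%N.
Proof. by move: r_gt0; rewrite def_r muln_gt0 => /andP[]. Qed.

Let d_gt0 : (0 < d)%N.
Proof. by move: r_gt0; rewrite def_r muln_gt0 => /andP[]. Qed.

Let xi_neq0 : xi != 0.
Proof. by rewrite (prim_root_eq0 xiP) muln_eq0 negb_or -!lt0n r_gt0. Qed.

(** s matches the coordinates with equal r-th powers; the ratio of matched coordinates is an r-th
    root of 1. *)
Lemma valid_trans a b : valid a -> valid b ->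
  exists (s : 'S_n) (c : 'I_n -> nat),
    forall i, pt xi b i = zeta ^+ c i * pt xi a (s i).
Proof.
move=> va vb.
pose ha (l : 'I_n) : 'I_n := inord (a l %% n).
pose hb (l : 'I_n) : 'I_n := inord (b l %% n).
have haE l : ha l = (a l %% n)%N :> nat by rewrite inordK // ltn_mod.
have hbE l : hb l = (b l %% n)%N :> nat by rewrite inordK // ltn_mod.
have ha_inj : injective ha.
  by move=> l l' /(congr1 (@nat_of_ord n)); rewrite !haE; apply: va.
have hb_inj : injective hb.
  by move=> l l' /(congr1 (@nat_of_ord n)); rewrite !hbE; apply: vb.
pose s : 'S_n := (perm hb_inj * (perm ha_inj)^-1)%g.
have eqs i : (a (s i) = b i %[mod n])%N.
  rewrite -haE -hbE; congr nat_of_ord.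
  by rewrite -[ha _](permE ha_inj) permM permKV permE.
have root_c i : exists c : nat, pt xi b i = zeta ^+ c * pt xi a (s i).
  have : (pt xi b i / pt xi a (s i)) ^+ r = 1.
    rewrite exprMn exprVn; have -> : pt xi b i ^+ r = pt xi a (s i) ^+ r.
      apply/eqP; rewrite -!exprM (eq_prim_root_expr xiP) ![(_ * r)%N]mulnC.
      by rewrite -!muln_modr eqs.
    by rewrite divff // !expf_neq0.
  case/(prim_rootP zetaP) => c def_c; exists c.
  by rewrite -def_c divfK // expf_neq0.
by have [c cP] := fin_all_exists root_c; exists s, c.
Qed.

Lemma meval_gmon_trans a b (s : 'S_n) (c : 'I_n -> nat) :
    (forall i, pt xi b i = zeta ^+ c i * pt xi a (s i)) ->
  g.@[pt xi b] = zeta ^+ (d * \sum_i c i) * g.@[pt xi a].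
Proof.
move=> eqb; rewrite !meval_gmon (eq_bigr _ (fun i _ => eqb i)) big_split /=.
rewrite prodrXr exprMn -exprM mulnC; congr (_ * _ ^+ _).
by rewrite [RHS](reindex_perm s).
Qed.

Lemma valid_ord : valid (fun j : 'I_n => j : nat).
Proof. by move=> j j' /=; rewrite !modn_small // => /val_inj. Qed.

Lemma valid_ordD l : valid (fun j : 'I_n => (j + l)%N).
Proof.
move=> j j' /eqP; rewrite eqn_modDr !modn_small // => /eqP; exact: val_inj.
Qed.

Lemma pt_shift a l j : pt xi (fun j => a j + l)%N j = xi ^+ l * pt xi a j.
Proof. by rewrite /pt exprD mulrC. Qed.

Lemma meval_gmon_shift a l :
  g.@[pt xi (fun j => a j + l)%N] = xi ^+ (n * d * l) * g.@[pt xi a].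
Proof.
rewrite (meval_eq _ (pt_shift a l)) (meval_homogZ _ _ (gmon_homog F n' d)).
by rewrite -exprM mulnC.
Qed.

Definition cone_invariant u := forall (s : 'S_n) (c : 'I_n -> nat) v,
  (p %| \sum_i c i)%N -> u.@[fun i => zeta ^+ c i * v (s i)] = u.@[v].

Variable u : S.
Hypotheses (u_inv : cone_invariant u) (u0 : u@_0%MM = 0).

(** Equal values of g force p to divide the sum of the colours relating the points, which thus lie
    in one orbit of G(r,p,n). *)
Lemma inv_orbit k a b : valid a -> valid b -> g.@[pt xi a] = g.@[pt xi b] ->
  (pihomog mdeg k u).@[pt xi b] = (pihomog mdeg k u).@[pt xi a].
Proof.
move=> va vb eqg; have [s [c eqb]] := valid_trans va vb.
apply: pihomog_eval_eq => t.
have dvdc : (p %| \sum_i c i)%N.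
  have /eqP := meval_gmon_trans eqb; rewrite -eqg -[X in X == _]mul1r.
  rewrite -subr_eq0 -mulrBl mulf_eq0 (negPf (gmon_pt_neq0 r_gt0 xiP d a)) orbF.
  rewrite subr_eq0 -(expr0 zeta) (eq_prim_root_expr zetaP) mod0n eq_sym.
  by rewrite -/(dvdn _ _) {1}def_r mulnC dvdn_pmul2l.
rewrite -(u_inv s (fun j => t * pt xi a j) dvdc); apply: meval_eq => i.
by rewrite eqb mulrCA.
Qed.

(** Values of g on Z differ by p-th roots of 1, and xi^(n d) is a primitive one. So g takes the same
    value at a and at some multiple xi^l of the base point, and [inv_orbit] applies. *)
Lemma inv_orbit_shift k a : valid a -> exists l : nat,
  g.@[pt xi a] = xi ^+ (n * d * l) * g.@[pt xi (fun j => j)] /\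
  (pihomog mdeg k u).@[pt xi a] =
    xi ^+ (k * l) * (pihomog mdeg k u).@[pt xi (fun j => j)].
Proof.
move=> va; have [s [c eqa]] := valid_trans valid_ord va.
have eqg := meval_gmon_trans eqa.
have prim_p : p.-primitive_root (xi ^+ (n * d)).
  have := dvdn_prim_root xiP (_ : p %| r * n)%N; rewrite def_r -mulnA.
  by rewrite mulKn // [(d * n)%N]mulnC; apply; rewrite dvdn_mulr.
have : (zeta ^+ (d * \sum_i c i)) ^+ p = 1.
  by rewrite -exprM mulnC mulnA -def_r exprM (prim_expr_order zetaP) expr1n.
case/(prim_rootP prim_p) => l def_l; exists l.
have eqgl : g.@[pt xi a] = xi ^+ (n * d * l) * g.@[pt xi (fun j => j)].
  by rewrite eqg def_l -exprM.
split=> //.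
rewrite (@inv_orbit k _ _ (@valid_ordD l) va); last by rewrite meval_gmon_shift eqgl.
rewrite (meval_eq _ (pt_shift _ l)) (meval_homogZ _ _ (pihomogP _ _ _)).
by rewrite -exprM mulnC.
Qed.

Lemma pihomog_inv_dec k : exists h, vanish xi (pihomog mdeg k u - g * h).
Proof.
set uk := pihomog mdeg k u; set id : 'I_n -> nat := fun j => j.
have ukP : uk \is k.-homog by apply: pihomogP.
have [ndvd|] := boolP (n * d %| k)%N; last first.
  move=> ndvd; exists 0; rewrite mulr0 subr0; apply: (vanish_homog ukP) => a va.
  have [l [_ ->]] := inv_orbit_shift k va; rewrite -/uk.
  suff -> : uk.@[pt xi id] = 0 by rewrite mulr0.
  have vid : valid id := valid_ord.
  (* Multiplying the base point by xi^p preserves g, as xi^(n d p) = 1, but multiplies the component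
     by xi^(k p), which is 1 only if n d divides k. *)
  have: uk.@[pt xi (fun j : 'I_n => j + p)%N] = uk.@[pt xi id].
    apply: inv_orbit => //; first exact: valid_ordD.
    rewrite meval_gmon_shift -mulnA [(d * p)%N]mulnC -def_r mulnC.
    by rewrite (prim_expr_order xiP) mul1r.
  rewrite (meval_eq _ (pt_shift _ p)) (meval_homogZ _ _ ukP) -[RHS]mul1r => /eqP.
  rewrite -subr_eq0 -mulrBl mulf_eq0 => /orP[|/eqP //].
  rewrite subr_eq0 -exprM -(expr0 xi) (eq_prim_root_expr xiP) mod0n -/(dvdn _ _).
  by rewrite {1}def_r -mulnA dvdn_pmul2l // [(d * n)%N]mulnC (negPf ndvd).
case/dvdnP: ndvd => [[|l'] def_k].
  (* In degree 0 only the constant term is left, and it is zero. *)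
  exists 0; rewrite mulr0 subr0 /uk def_k mul0n.
  suff -> : pihomog mdeg 0 u = 0 by apply: vanish0.
  rewrite pihomogE big1 // => m; rewrite mdeg_eq0 => /eqP ->.
  by rewrite u0 scale0r.
(* On Z the component equals c g^(l' + 1), with c computed at the base point. *)
pose G0 := g.@[pt xi id]; pose c := uk.@[pt xi id] / G0 ^+ l'.+1.
have G0_neq0 : G0 != 0 := gmon_pt_neq0 r_gt0 xiP d id.
exists (c *: g ^+ l'); apply: (@vanish_homog _ _ _ k).
  apply: rpredB => //; rewrite -scalerAr -exprS; apply: dhomogZ.
  by rewrite def_k mulnC; apply: dhomogMn; apply: gmon_homog.
move=> a va; have [l [eqg equ]] := inv_orbit_shift k va.
rewrite mevalB equ -scalerAr -exprS mevalZ rmorphXn /= eqg -/uk -/id -/G0 exprMn.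
rewrite mulrCA divfK ?expf_neq0 // def_k -exprM.
by rewrite [(l'.+1 * _)%N]mulnC mulnAC subrr.
Qed.

Lemma inv_dec : exists h, vanish xi (u - g * h).
Proof.
have [] : exists h, vanish xi (\sum_(k < msize u) pihomog mdeg k u - g * h); last first.
  by move=> h; rewrite -pihomog_partitionE // => vh; exists h.
elim/big_ind: _ => [|f f' [h vh] [h' vh']|k _]; last exact: pihomog_inv_dec.
  by exists 0; rewrite mulr0 subr0; apply: vanish0.
by exists (h + h'); rewrite mulrDr opprD addrACA; apply: vanishD.
Qed.

End InvariantsOnCone.

(** If the order m were less than N, x = pi m / N would lie strictly between 0 and pi, while cos 2x
    = 1 gives sin x = 0. *)
Lemma zeta_prim (R : realType) N : (0 < N)%N -> N.-primitive_root (zeta R N).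
Proof.
move=> N_gt0; have [m mP dvdm] := prim_order_exists N_gt0 (zeta_unity R N_gt0).
have m_gt0 := prim_order_gt0 mP.
have := dvdn_leq N_gt0 dvdm; rewrite leq_eqVlt => /predU1P[eqm|ltm].
  by rewrite -{1}eqm.
have NR_gt0 : (0 : R) < N%:R by rewrite ltr0n.
pose x : R := pi / N%:R * m%:R.
have x_gt0 : 0 < x by rewrite mulr_gt0 ?divr_gt0 ?pi_gt0 ?ltr0n.
have x_lt : x < pi.
  rewrite /x mulrAC ltr_pdivrMr // ltr_pM2l; last exact: pi_gt0.
  by rewrite ltr_nat.
have := prim_expr_order mP; rewrite zetaX => /(congr1 (@complex.Re R)) /=.
have -> : 2 * pi / N%:R * m%:R = x *+ 2 by rewrite /x -!mulrA mulr_natl.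
rewrite cos_mulr2n => cos2; have cos1 : cos x ^+ 2 = 1 by lra.
have := sin2cos2 x; rewrite cos1 subrr => /eqP; rewrite sqrf_eq0 gt_eqF //.
by rewrite sin_gt0_pi ?x_gt0.
Qed.

(** * The projection onto the coinvariant algebra *)

Section CoinvPi.
Variables (F : fieldType) (gT : finGroupType) (G : {group gT}) (n : nat).
Variable rG : mx_representation F G n.

Lemma coinv_pi_is_linear : linear (coinv_pi rG).
Proof.
by move=> c f g; rewrite /coinv_pi rmorphD -mul_mpolyC rmorphM.
Qed.

HB.instance Definition _ := GRing.isLinear.Build F {mpoly F[n]} (coinv rG) _
  (coinv_pi rG) coinv_pi_is_linear.

Lemma coinv_pi_eq0 f : coinv_pi rG f = 0 <-> f \in coinv_ideal rG.
Proof.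
rewrite -[f in f \in _]subr0 Quotient.idealrBE /coinv_pi; split=> [pf|/eqP ->].
  by rewrite pf rmorph0.
by rewrite rmorph0.
Qed.

End CoinvPi.

(** * The invariants of G(r,p,n) *)

Section GrpnInvariants.
Variables (R : realType) (r n' p : nat).
Local Notation n := n'.+1.
Hypotheses (r_gt0 : (0 < r)%N) (p_gt0 : (0 < p)%N) (dvd_pr : (p %| r)%N).
Local Notation d := (r %/ p)%N.
Local Notation rG := (Grpn_repr R n dvd_pr).
Local Notation S := {mpoly R[i][n]}.
Local Notation z := (zeta R r).

Let def_r : r = (p * d)%N. Proof. by rewrite mulnC divnK. Qed.

(** Stated for x^-1 because the action substitutes the inverse matrix, which is then that of x. *)
Lemma poly_actXU x i :
  poly_act rG x^-1%g 'X_i = z ^+ wcol x i *: 'X_((wperm x)^-1%g i).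
Proof.
rewrite /poly_act comp_mpolyXU -tnth_nth tnth_mktuple invgK (bigD1 ((wperm x)^-1%g i)) //=.
rewrite Grn_mxE permKV eqxx mulr1 big1 ?addr0 // => j neqj.
rewrite Grn_mxE; case: eqP => [eqi|_]; last by rewrite mulr0 scale0r.
by rewrite eqi permK eqxx in neqj.
Qed.

Lemma meval_poly_act x (f : S) v :
  (poly_act rG x^-1%g f).@[v] =
  f.@[fun i => z ^+ wcol x i * v ((wperm x)^-1%g i)].
Proof.
rewrite /poly_act comp_mpoly_meval; apply: meval_eq => i.
have := poly_actXU x i; rewrite /poly_act comp_mpolyXU -tnth_nth => ->.
by rewrite mevalZ mevalXU.
Qed.

Lemma invariant_polyV (f : S) :
  (forall x, x \in Grpn n dvd_pr -> poly_act rG x^-1%g f = f) -> invariant_poly rG f.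
Proof. by move=> fx x Gx; rewrite -[x]invgK fx // groupV. Qed.

Lemma cone_invariantP (u : S) : invariant_poly rG u -> cone_invariant p z u.
Proof.
move=> u_inv s c v dvdc.
(* Colours are reduced modulo r, which keeps their sum modulo p; s is inverted because the action
   reads coordinates through the inverse permutation. *)
pose x : wreath r n := Wreath [ffun i => inZp (c i)] (s^-1)%g.
have Gx : x \in Grpn n dvd_pr.
  rewrite inE /dvdn -modn_summ (eq_bigr (fun i => (c i %% p)%N)) => [|i _].
    by rewrite modn_summ.
  by rewrite ffunE /= modn_dvdm // prednK.
rewrite -{2}(u_inv x^-1%g) ?groupV // meval_poly_act; apply: meval_eq => i.
by rewrite ffunE /= invgK prednK // (expr_mod _ (zeta_unity R r_gt0)).
Qed.

(** The group permutes the y_l, as zeta^r = 1. *)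
Lemma sym_gen_inv a : (0 < a)%N ->
  invariant_poly rG (sym_gen R[i] r n')`_a /\ ((sym_gen R[i] r n')`_a)@_0%MM = 0.
Proof.
move=> a_gt0; split.
  apply: invariant_polyV => x Gx; rewrite {1}/poly_act -coef_map; congr ((polyseq _)`_a).
  rewrite /sym_gen rmorph_prod /= [RHS](reindex_perm (wperm x)^-1%g).
  apply: eq_bigr => l _; rewrite rmorphB rmorph1 /= map_polyZ map_polyX rmorphXn /=.
  have := poly_actXU x l; rewrite /poly_act => ->.
  by rewrite exprZn -exprM mulnC exprM zeta_unity // expr1n scale1r.
have -> : ((sym_gen R[i] r n')`_a)@_0%MM =
    (map_poly (mcoeff 0%MM) (sym_gen R[i] r n'))`_a by rewrite coef_map.
rewrite /sym_gen rmorph_prod /= big1 ?coef1 ?gtn_eqF // => l _.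
rewrite rmorphB rmorph1 /= map_polyZ map_polyX rmorphXn /= mcoeffX.
have -> : (U_(l)%MM == 0%MM) = false.
  by apply/negP => /eqP/(congr1 (@mdeg _)); rewrite mdeg1 mdeg0.
by rewrite expr0n gtn_eqF // scale0r subr0.
Qed.

Lemma gmon_inv :
  invariant_poly rG (gmon R[i] n' d) /\ (gmon R[i] n' d)@_0%MM = 0.
Proof.
have d_gt0 : (0 < d)%N by rewrite divn_gt0 // dvdn_leq.
split.
  apply: invariant_polyV => x; rewrite inE => dvdx.
  rewrite /gmon {1}/poly_act rmorphXn rmorph_prod /=.
  rewrite (eq_bigr (fun i => z ^+ wcol x i *: 'X_((wperm x)^-1%g i))) => [|i _].
    rewrite scaler_prod prodrXr exprZn -exprM mulnC.
    have -> : z ^+ (d * \sum_i wcol x i)%N = 1.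
      case/dvdnP: dvdx => q ->; rewrite mulnCA -[(d * p)%N]mulnC -def_r mulnC exprM.
      by rewrite zeta_unity // expr1n.
    rewrite scale1r; apply: (congr1 (fun f : S => f ^+ d)).
    by rewrite [RHS](reindex_perm (wperm x)^-1%g).
  exact: poly_actXU.
rewrite /gmon rmorphXn rmorph_prod /= big_ord_recl mcoeffX.
have -> : (U_(@ord0 n')%MM == 0%MM) = false.
  by apply/negP => /eqP/(congr1 (@mdeg _)); rewrite mdeg1 mdeg0.
by rewrite mul0r expr0n gtn_eqF.
Qed.

Lemma coinv_ideal_gen (u : S) :
  invariant_poly rG u -> u@_0%MM = 0 -> u \in coinv_ideal rG.
Proof.
move=> u_inv u0; apply/asboolP; exists 1%N, (fun=> 1), (fun=> u).
by split=> //; rewrite big_ord1 mul1r.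
Qed.

Lemma Grpn_is_Hilb k :
  has_dim (@coinv_homog _ _ _ _ rG k)
    (#|std_deg r n' k| - #|std_deg_shift r n' d k|).
Proof.
have rn_gt0 : (0 < r * n)%N by rewrite muln_gt0 r_gt0.
have xiP := zeta_prim R rn_gt0.
have [I0 _ ILC] := coinv_ideal_closed rG.
apply: (@coinv_dim _ r n' d _ r_gt0 xiP (fun f => f \in coinv_ideal rG) _ _ _ _ _ _
  (coinv rG) (coinv_pi rG)).
- exact: I0.
- by move=> f g If Ig; rewrite -[f]mul1r; apply: ILC.
- by move=> f g Ig; rewrite -[f * g]addr0; apply: ILC.
- move=> a /andP[a_gt0 _]; have [] := sym_gen_inv a_gt0; exact: coinv_ideal_gen.
- by have [] := gmon_inv; apply: coinv_ideal_gen.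
(* By linearity it suffices to treat a multiple of one invariant without constant term, by
   [inv_dec]. *)
- move=> f /asboolP[m [h [u [uP ->]]]].
  elim/big_ind: _ => [|f1 f2 [h1 v1] [h2 v2]|i _].
  + by exists 0; rewrite mulr0 subr0; apply: vanish0.
  + by exists (h1 + h2); rewrite mulrDr opprD addrACA; apply: vanishD.
  have [ui u0] := uP i.
  have [hi vi] := inv_dec r_gt0 def_r (zeta_prim R r_gt0) xiP (cone_invariantP ui) u0.
  exists (h i * hi); rewrite mulrCA -mulrBr; exact: vanishM.
- exact: coinv_pi_eq0.
Qed.

End GrpnInvariants.

Theorem theorem2p4 (R : realType) (r n p : nat)
    (r_gt0 : (0 < r)%N) (n_gt0 : (0 < n)%N) (p_gt0 : (0 < p)%N)
    (dvd_pr : (p %| r)%N) (gcd1 : gcdn n (gcdn p (r %/ p)) = 1%N) :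
  exists (s : nat) (a : s.-tuple (wreath r n)),
    perfect_hilbertian_basis (Grpn_repr R n dvd_pr) a.
Proof.
case: n n_gt0 gcd1 => // n' _ gcd1.
have basisP := Grpn_perfect_basis r_gt0 p_gt0 dvd_pr gcd1.
exists n'.+1, (Grpn_basis r n' p); split=> // k.
rewrite (coef_Fmaj k basisP).
(* The orders of the generators are the exponent bounds in [card_std_diff]. *)
rewrite -(@card_std_diff r n' (r %/ p) k) => [|i]; first exact: Grpn_is_Hilb.
rewrite Grpn_basis_orders // /Grpn_ord; case: ltnP => [_|lei]; first by rewrite mulnC.
by congr (_ * _)%N; apply/eqP; rewrite eqn_leq ltn_ord.
Qed.
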